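(* For each $n \in \mathbb{N}$ let $p_n \in \mathbb{N}$ with $p_n \to \infty$ as $n \to \infty$, and let $x_1, \ldots, x_n$ be a random sample from $\mathcal{N}_{p_n}(\mu_n, \Sigma_n)$, where $\mu_n \in \mathbb{R}^{p_n}$ and $\Sigma_n \in \mathbb{R}^{p_n \times p_n}$ is positive definite. Let $d \geq 1$ be a fixed integer (not depending on $n$) and $\sigma^2 > 0$ a fixed constant, and assume that the eigenvalues of $\Sigma_n$ are $\lambda_{n1} \geq \cdots \geq \lambda_{nd} > \sigma^2 = \cdots = \sigma^2$ (i.e. the $p_n - d$ smallest eigenvalues all equal $\sigma^2$), with $\lambda_{nk} \to \infty$ as $n \to \infty$ for each $k = 1, \ldots, d$. Let $S_n$ be the sample covariance matrix, and for $k = 0, \ldots, p_n - 1$ define $$T_{n,k} := \frac{m_{2,p_n-k}(S_n)}{m_{1,p_n-k}(S_n)^2} - 1, \qquad g_{n,k} := (n-k-1)\,T_{n,k} - (p_n - k).$$ Suppose that, as $n \to \infty$, either (i) $p_n/n \to \gamma \in [0,\infty) \setminus \{1\}$ and $p_n/\lambda_{nd}^2 \to 0$, or (ii) $p_n/n \to \infty$, $p_n/(n\sqrt{\lambda_{nd}}) \to 0$ and $p_n/(\sqrt{n}\,\lambda_{nd}) \to 0$. Then for each $k = 0, \ldots, d-1$ and every $M > 0$, $$\mathbb{P}(g_{n,k}/n \leq M) \to 0 \quad \text{as } n \to \infty.$$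
   Context: For a symmetric $p \times p$ matrix $A$ with eigenvalues $\phi_1(A) \geq \cdots \geq \phi_p(A)$ and $1 \leq r \leq p$, $m_{\ell,r}(A) := \frac{1}{r}\sum_{i=p-r+1}^{p} \phi_i(A)^\ell$ denotes the $\ell$th sample moment of the $r$ smallest eigenvalues of $A$. The sample covariance matrix is $S_n = \frac{1}{n-1}\sum_{i=1}^n (x_i - \bar{x})(x_i - \bar{x})'$ with $\bar{x}$ the sample mean. *)

(* Defs.v *)
From HB Require Import structures.
From mathcomp Require Import all_boot all_order all_algebra.
From mathcomp Require Import all_classical all_reals all_analysis.
Set Implicit Arguments. Unset Strict Implicit. Unset Printing Implicit Defensive.
Import Order.TTheory GRing.Theory Num.Theory.
Import numFieldNormedType.Exports.
Local Open Scope classical_set_scope.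
Local Open Scope ring_scope.

Section Defs.
Context {R : realType}.

Definition sample_mean (n p : nat) (x : 'I_n -> 'I_p -> R) : 'I_p -> R :=
  fun j => (n%:R)^-1 * \sum_(i < n) x i j.

Definition sample_cov (n p : nat) (x : 'I_n -> 'I_p -> R) : 'M[R]_p :=
  \matrix_(j, l) ((n%:R - 1)^-1 *
     \sum_(i < n) (x i j - sample_mean x j) * (x i l - sample_mean x l)).

Definition is_spectrum (p : nat) (A : 'M[R]_p) (s : seq R) : bool :=
  sorted (fun a b : R => b <= a) s &&
  (char_poly A == \prod_(c <- s) ('X - c%:P)).

(** eigs A = [:: phi_1(A); ...; phi_p(A)] with phi_1 >= ... >= phi_p
    (well-defined for symmetric real A, whose characteristic polynomial
    splits over R) *)
Definition eigs (p : nat) (A : 'M[R]_p) : seq R :=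
  xget [::] [set s | is_spectrum A s].

Definition mom (p : nat) (l r : nat) (A : 'M[R]_p) : R :=
  (r%:R)^-1 * \sum_(c <- drop (p - r) (eigs A)) c ^+ l.

Definition T_stat (n p k : nat) (x : 'I_n -> 'I_p -> R) : R :=
  mom 2 (p - k) (sample_cov x) / (mom 1 (p - k) (sample_cov x)) ^+ 2 - 1.

Definition g_stat (n p k : nat) (x : 'I_n -> 'I_p -> R) : R :=
  (n%:R - k%:R - 1) * T_stat k x - (p%:R - k%:R).

Definition posdef (p : nat) (S : 'M[R]_p) : Prop :=
  S^T = S /\ forall v : 'cV[R]_p, v != 0 -> 0 < (v^T *m S *m v) ord0 ord0.

(** X = (X i j) is a random sample x_1, ..., x_n (x_i = (X i j)_j) from
    N_p(mu, Sig): each x_i has law N_p(mu, Sig) (every nonzero linear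
    combination a'x_i is N(a'mu, a'Sig a)), and x_1, ..., x_n are mutually
    independent (product rule on measurable rectangles). *)
Definition gaussian_sample {d : measure_display} {T : measurableType d}
  (P : probability T R) (n p : nat) (mu : 'cV[R]_p) (Sig : 'M[R]_p)
  (X : 'I_n -> 'I_p -> {RV P >-> R}) : Prop :=
  (forall (i : 'I_n) (a : 'I_p -> R), (exists j, a j != 0) ->
     forall B : set R, measurable B ->
       P ((fun t => \sum_(j < p) a j * X i j t) @^-1` B) =
       normal_prob (\sum_(j < p) a j * mu j ord0)
                   (Num.sqrt (\sum_(j < p) \sum_(l < p) a j * Sig j l * a l)) B)
  /\
  (forall B : 'I_n -> 'I_p -> set R, (forall i j, measurable (B i j)) ->
     P [set t | forall i j, B i j (X i j t)] =
     (\prod_(i < n) P [set t | forall j, B i j (X i j t)])%E).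

End Defs.

(* Main.v *)
Require Import Defs.
From HB Require Import structures.
From mathcomp Require Import all_boot all_order all_algebra.
From mathcomp Require Import complex.
From mathcomp Require Import all_classical all_reals all_analysis.
From mathcomp Require Import measurable_realfun ring lra.
Import Order.TTheory GRing.Theory Num.Theory.
Import numFieldNormedType.Exports.
Local Open Scope classical_set_scope.
Local Open Scope ring_scope.

(** Let [l_1 >= ... >= l_p] be the eigenvalues of [S_n] and [r = p - k].  Then
    [T + 1 = r * sum l_i^2 / (sum l_i)^2], the sums running over [i > k].
    If [l_d >= L] and [l_{d+1} + ... + l_p <= K p], this is at least
    [r * (L / (d L + K p))^2], and either growth condition makes it beat
    [p / n + M] as soon as [L] is a fixed multiple of [lam_d].

    The upper bound is Ky Fan's principle on the noise eigenspace of [Sigma]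
    together with Markov's inequality.  The lower bound follows from
    Courant-Fischer once the sample covariance of the whitened spike coordinates
    is bounded below on the unit sphere of R^d.  For one direction, a positive
    fraction of the sample lies more than one standard deviation above the mean
    and a positive fraction more than one below (Chebyshev's inequality for
    pairwise independent events), which bounds the sample variance from below
    whatever the empirical mean is; a finite net extends this to all directions.
    Only crude moment bounds are needed, because [K] may depend on the target
    probability.

    A measure has junk values on non-measurable sets, so the event of the theorem
    must also be shown measurable. *)

(** * Real spectral theorem *)

Lemma char_poly_conj (R : comNzRingType) (p : nat) (A P Q : 'M[R]_p) :
  P *m Q = 1%:M -> char_poly (P *m A *m Q) = char_poly A.
Proof.
move=> PQ1.
have PQ1' : map_mx polyC P *m map_mx polyC Q = 1%:M.
  by rewrite -map_mxM PQ1 map_mx1.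
have -> : char_poly (P *m A *m Q) =
    \det (map_mx polyC P *m char_poly_mx A *m map_mx polyC Q).
  rewrite /char_poly /char_poly_mx !map_mxM mulmxBr mulmxBl; congr (\det (_ - _)).
  by rewrite scalar_mxC -mulmxA PQ1' mulmx1.
rewrite !det_mulmx mulrAC -det_mulmx PQ1' det1 mul1r //.
Qed.

Lemma char_poly_block_diag (R : comNzRingType) (p q : nat) (A : 'M[R]_p)
    (B : 'M[R]_q) :
  char_poly (block_mx A 0 0 B) = char_poly A * char_poly B.
Proof.
rewrite /char_poly /char_poly_mx map_block_mx !map_mx0 scalar_mx_block.
by rewrite opp_block_mx add_block_mx !oppr0 !addr0 det_ublock.
Qed.

(** Over the complex extension the matrix is Hermitian, hence unitarily diagonalizable with a real
    diagonal. The factorization descends because the embedding of polynomials is injective. *)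
Lemma sym_char_poly_split (R : rcfType) (p : nat) (A : 'M[R]_p) : A^T = A ->
  exists s : seq R, char_poly A = \prod_(c <- s) ('X - c%:P).
Proof.
move=> symA.
pose f := real_complex R.
pose B := map_mx f A.
have realB : B \is a mxOver Num.real.
  by apply/mxOverP => i j; rewrite mxE complex_real.
have hB : B \is hermsymmx.
  apply: realsym_hermsym => //; apply/is_hermitianmxP.
  rewrite expr0 scale1r map_mx_id //; apply/matrixP => i j.
  by rewrite !mxE -{1}symA mxE.
have /mxOverP rD := hermitian_spectral_diag_real hB.
have Beq := orthomx_spectralP (hermitian_normalmx hB).
set D := spectral_diag B in rD Beq.
exists [seq complex.Re (D ord0 i) | i <- enum 'I_p].
apply: (@map_poly_inj _ _ f).
rewrite map_char_poly -/B Beq char_poly_conj; last first.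
  by rewrite mulVmx // spectral_unit.
rewrite char_poly_trig ?diag_mx_is_trig // rmorph_prod big_map big_enum /=.
apply: eq_bigr => i _.
rewrite !mxE eqxx map_polyXsubC; congr (_ - _%:P).
by symmetry; apply: RRe_real; exact: rD.
Qed.

(** * Squared norms, quadratic forms and reflections *)

Section SquaredNorm.
Context {R : realFieldType}.
Implicit Types p : nat.

Definition sqn p (a : 'rV[R]_p) : R := \sum_(i < p) a ord0 i ^+ 2.

(** Vectors are rows, so rows of orthogonal matrices and images [b *m U] can be inserted without
    transposing. *)
Definition qf p (A : 'M[R]_p) (a : 'rV[R]_p) : R := (a *m A *m a^T) ord0 ord0.

Lemma sqnE p (a : 'rV[R]_p) : sqn p a = (a *m a^T) ord0 ord0.
Proof. by rewrite mxE; apply: eq_bigr => i _; rewrite mxE expr2. Qed.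

Lemma qfE p (A : 'M[R]_p) (a : 'rV[R]_p) :
  qf p A a = \sum_(i < p) \sum_(j < p) a ord0 i * A i j * a ord0 j.
Proof.
rewrite /qf mxE exchange_big /=; apply: eq_bigr => j _.
by rewrite !mxE mulr_suml.
Qed.

Lemma sqn_ge0 p (a : 'rV[R]_p) : 0 <= sqn p a.
Proof. by apply: sumr_ge0 => i _; rewrite sqr_ge0. Qed.

Lemma sqn_gt0 p (a : 'rV[R]_p) : a != 0 -> 0 < sqn p a.
Proof.
move=> a0; rewrite lt_def sqn_ge0 andbT; apply: contra a0 => /eqP h.
apply/eqP/rowP => i; rewrite mxE; apply/eqP.
have /eqP := h; rewrite psumr_eq0; last by move=> j _; rewrite sqr_ge0.
by move=> /allP/(_ i); rewrite mem_index_enum => /(_ isT) /=; rewrite sqrf_eq0.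
Qed.

Lemma sqn_isometry p q (a : 'rV[R]_p) (U : 'M[R]_(p, q)) :
  U *m U^T = 1%:M -> sqn q (a *m U) = sqn p a.
Proof. by move=> hU; rewrite !sqnE trmx_mul mulmxA -(mulmxA a) hU mulmx1. Qed.

Lemma qf_diag p (V : 'M[R]_p) (D : 'rV[R]_p) (a : 'rV[R]_p) :
  qf p (V^T *m diag_mx D *m V) a = \sum_i D ord0 i * (a *m V^T) ord0 i ^+ 2.
Proof.
have -> : qf p (V^T *m diag_mx D *m V) a =
    ((a *m V^T) *m diag_mx D *m (a *m V^T)^T) ord0 ord0.
  by rewrite /qf trmx_mul trmxK !mulmxA.
rewrite mxE; apply: eq_bigr => i _; rewrite mul_mx_diag mxE [_^T _ _]mxE.
ring.
Qed.

(** The reflection along [w = v - e] exchanges the unit vectors [v] and [e], since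
    [sqn w = 2 - 2 v_0]. The case [v = e], where [w] vanishes, is served by the identity. *)
Lemma householder p (v : 'rV[R]_p.+1) : sqn p.+1 v = 1 ->
  exists H : 'M[R]_p.+1, [/\ H^T = H, H *m H = 1%:M & row ord0 H = v].
Proof.
move=> v1.
pose e : 'rV[R]_p.+1 := delta_mx ord0 ord0.
have [->|ve] := eqVneq v e.
  exists 1%:M; split; rewrite ?trmx1 ?mulmx1 //.
  by rewrite rowE mulmx1.
pose w := v - e; pose c := 2 / sqn p.+1 w.
have w0 : 0 < sqn p.+1 w by rewrite sqn_gt0 // subr_eq0.
exists (1%:M - c *: (w^T *m w)); split.
- by rewrite linearB /= linearZ /= trmx_mul trmxK trmx1.
- rewrite mulmxBr mulmx1 mulmxBl mul1mx -scalemxAl -scalemxAr.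
  rewrite mulmxA -(mulmxA w^T w w^T) (mx11_scalar (w *m w^T)) -sqnE.
  rewrite mul_mx_scalar -scalemxAl !scalerA.
  have -> : c * (c * sqn p.+1 w) = c + c.
    by rewrite /c; field; rewrite gt_eqF.
  by rewrite scalerDl opprB addrK subrK.
- rewrite rowE -/e mulmxBr mulmx1 -scalemxAr mulmxA.
  rewrite (mx11_scalar (_ *m w^T)) mul_scalar_mx scalerA.
  have -> : c * (e *m w^T) ord0 ord0 = -1.
    have -> : (e *m w^T) ord0 ord0 = v ord0 ord0 - 1.
      by rewrite -rowE !mxE !eqxx.
    rewrite /c.
    have h : sqn p.+1 w = -2 * (v ord0 ord0 - 1).
      rewrite /sqn big_ord_recl; under eq_bigr => i _ do rewrite !mxE /= subr0.
      move: v1; rewrite /sqn big_ord_recl => /eqP; rewrite addrC eq_sym -subr_eq eq_sym.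
      by move=> /eqP ->; rewrite !mxE !eqxx /=; ring.
    have h0 : v ord0 ord0 - 1 != 0.
      by apply/eqP => h0; move: w0; rewrite h h0 mulr0 ltxx.
    by rewrite h; field; rewrite h0.
  by rewrite scaleN1r opprK addrC subrK.
Qed.

End SquaredNorm.
Arguments sqn {R p}.
Arguments qf {R p}.

(* The eigenvalues may be listed in any order [s]. *)
Lemma sym_orthodiag (R : rcfType) (p : nat) (A : 'M[R]_p) (s : seq R) :
  A^T = A -> char_poly A = \prod_(c <- s) ('X - c%:P) ->
  exists V : 'M[R]_p,
    V *m V^T = 1%:M /\ A = V^T *m diag_mx (\row_i s`_i) *m V.
Proof.
elim: p A s => [|p IHp] A s symA chA.
  by exists 0; split; apply/matrixP => -[].
case: s chA => [|c s] chA.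
  have := size_char_poly A; rewrite chA big_nil size_poly1 //.
have /eigenvalueP[u uA u0] : eigenvalue A c.
  by rewrite eigenvalue_root_char chA big_cons rootM root_XsubC eqxx.
pose v := (Num.sqrt (sqn u))^-1 *: u.
have su0 : Num.sqrt (sqn u) != 0 by rewrite gt_eqF // sqrtr_gt0 sqn_gt0.
have v1 : sqn v = 1.
  rewrite /sqn; under eq_bigr => i _ do rewrite mxE exprMn.
  rewrite -mulr_sumr -/(sqn u) -{2}(sqr_sqrtr (sqn_ge0 _ u)) exprVn mulVf //.
  by rewrite sqrf_eq0.
have vA : v *m A = c *: v by rewrite -scalemxAl uA !scalerA mulrC.
(* Deflation: conjugating by a reflection whose first row is a unit eigenvector for [c] splits off a
   block [c]. Cancelling ['X - c] in the characteristic polynomial leaves the product over the tail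
   [s] for the other block. *)
have [H [Hsym HH rowH]] := householder _ _ v1.
pose B : 'M[R]_(1 + p) := H *m A *m H.
have Bsym : B^T = B by rewrite /B !trmx_mul Hsym symA mulmxA.
have rowB : row ord0 B = c *: delta_mx ord0 ord0.
  rewrite /B !row_mul rowH vA -scalemxAl; congr (_ *: _).
  by rewrite -rowH -row_mul HH rowE mulmx1.
have chBA : char_poly B = char_poly A by rewrite char_poly_conj.
have AB : A = H *m B *m H.
  by rewrite /B !mulmxA HH mul1mx -mulmxA HH mulmx1.
clearbody B.
have B0 (i j : 'I_(1 + p)) : i = 0%N :> nat -> B i j = c *+ (j == 0%N :> nat).
  move=> i0; have /rowP/(_ j) := rowB; rewrite !mxE => h.
  have -> : i = ord0 by exact: val_inj.
  by rewrite h mulr_natr.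
have Bblock : B = block_mx c%:M 0 0 (drsubmx B).
  rewrite -{1}(submxK B); congr block_mx; apply/matrixP => i j.
  - by rewrite !mxE !ord1 /= B0.
  - by rewrite !mxE !ord1 /= B0.
  - by rewrite !mxE !ord1 /= -Bsym mxE B0.
have chB : char_poly (drsubmx B) = \prod_(c <- s) ('X - c%:P).
  move: chBA; rewrite Bblock char_poly_block_diag chA big_cons.
  have -> : char_poly (c%:M : 'M[R]_1) = 'X - c%:P.
    by rewrite char_poly_trig ?scalar_mx_is_trig // big_ord1 !mxE eqxx.
  by move/(mulfI (negbT (polyXsubC_eq0 c))); rewrite -Bblock.
have [V' [VV' BV']] : exists V : 'M[R]_p,
    V *m V^T = 1%:M /\ drsubmx B = V^T *m diag_mx (\row_i s`_i) *m V.
  apply: IHp => //.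
  by rewrite trmx_drsub Bsym.
pose V1 : 'M[R]_(1 + p) := block_mx 1%:M 0 0 V'.
have VV1 : V1 *m V1^T = 1%:M.
  rewrite /V1 tr_block_mx !trmx0 trmx1 mulmx_block !mulmx0 !mul0mx !mulmx1 VV'.
  by rewrite !addr0 add0r -scalar_mx_block.
have -> : A = H *m B *m H by [].
have DE : block_mx c%:M 0 0 (diag_mx (\row_i s`_i)) =
    diag_mx (\row_i (c :: s)`_i) :> 'M[R]_(1 + p).
  rewrite -[RHS](submxK (_ : 'M[R]_(1 + p))); congr block_mx; apply/matrixP => i j;
    rewrite !mxE ?ord1 //= ?eqxx //.
have BV : B = V1^T *m diag_mx (\row_i (c :: s)`_i) *m V1.
  rewrite Bblock BV' -DE /V1 tr_block_mx !trmx0 trmx1 !mulmx_block.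
  by rewrite !mulmx0 !mul0mx !mulmx1 !mul1mx !addr0 !add0r mul0mx.
exists (V1 *m H); split.
  by rewrite trmx_mul Hsym mulmxA -(mulmxA V1) HH mulmx1.
by rewrite BV trmx_mul Hsym !mulmxA.
Qed.

(** * Ordered eigenvalues of a symmetric matrix *)

Lemma rowsub_orthonormal (R : comNzRingType) (m p : nat) (V : 'M[R]_p)
    (f : 'I_m -> 'I_p) :
  injective f -> V *m V^T = 1%:M -> rowsub f V *m (rowsub f V)^T = 1%:M.
Proof.
move=> finj VV; apply/matrixP => i j; have /matrixP/(_ (f i) (f j)) := VV.
rewrite [RHS]mxE (inj_eq finj) => E; rewrite [RHS]mxE -E !mxE.
by apply: eq_bigr => l _; rewrite !mxE.
Qed.

(** The default [[::]] of [xget] is not what gets chosen: sorting the roots of the split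
    characteristic polynomial exhibits a spectrum. *)
Lemma spectrum_eigs (R : realType) (p : nat) (A : 'M[R]_p) : A^T = A ->
  is_spectrum A (eigs A).
Proof.
move=> symA; have [s hs] := sym_char_poly_split _ _ _ symA.
rewrite /eigs; case: xgetP => [y -> //|/(_ (sort (fun a b => b <= a) s))[]].
apply/andP; split.
  by apply: sort_sorted => a b; exact: le_total.
by rewrite hs; apply/eqP/perm_big; rewrite perm_sym; apply/permPl/perm_sort.
Qed.

(** * Variational bounds and perturbation of eigenvalues *)

Section Eigs.
Context {R : realType} {p : nat}.
Implicit Types A B : 'M[R]_p.

Lemma size_eigs A : A^T = A -> size (eigs A) = p.
Proof.
move=> /spectrum_eigs/andP[_ /eqP chA].
have := size_char_poly A; rewrite chA size_prod_XsubC.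
by move=> [].
Qed.

Lemma eigs_nonincr A (i j : nat) : A^T = A -> (i <= j < p)%N ->
  (eigs A)`_j <= (eigs A)`_i.
Proof.
move=> symA /andP[ij jp]; have /andP[srt _] := spectrum_eigs _ _ _ symA.
apply: (sorted_leq_nth _ _ _ srt) => //.
- by move=> y x z /= xy yz; exact: le_trans yz xy.
- by rewrite inE size_eigs // (leq_ltn_trans ij jp).
- by rewrite inE size_eigs.
Qed.

Lemma eigs_orthodiag A : A^T = A -> exists V : 'M[R]_p,
  V *m V^T = 1%:M /\ A = V^T *m diag_mx (\row_i (eigs A)`_i) *m V.
Proof.
move=> symA; have /andP[_ /eqP chA] := spectrum_eigs _ _ _ symA.
exact: sym_orthodiag.
Qed.

(* Half of Courant-Fischer: some nonzero vector in the span of the [d.+1]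
   rows of [U] is orthogonal to the first [d] eigenvectors of [A]. *)
Lemma eigs_nth_ge A (d : nat) (U : 'M[R]_(d.+1, p)) (c : R) :
  A^T = A -> (d < p)%N -> U *m U^T = 1%:M ->
  (forall b : 'rV[R]_d.+1, c * sqn b <= qf A (b *m U)) -> c <= (eigs A)`_d.
Proof.
move=> symA dp UU hU; have [V [VV AE]] := eigs_orthodiag _ symA.
pose G : 'M[R]_(d.+1, d) := \matrix_(i, j) (U *m V^T) i (widen_ord (ltnW dp) j).
have [b b0 bG] : exists2 b : 'rV[R]_d.+1, b != 0 & b *m G = 0.
  have : (0 < \rank (kermx G))%N.
    by rewrite mxrank_ker subn_gt0 ltnS rank_leq_col.
  rewrite lt0n mxrank_eq0 => /rowV0Pn[b bK b0].
  by exists b => //; apply/sub_kermxP.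
have VTV : V^T *m V = 1%:M by apply: mulmx1C.
have hx i : (i < d)%N -> forall ip : (i < p)%N,
    (b *m U *m V^T) ord0 (Ordinal ip) = 0.
  move=> id ip; have /rowP/(_ (Ordinal id)) := bG.
  rewrite [in X in _ = X]mxE => <-; rewrite -mulmxA !mxE.
  apply: eq_bigr => k _; rewrite [G _ _]mxE; congr (_ * (U *m V^T) _ _).
  exact: val_inj.
have : c * sqn b <= (eigs A)`_d * sqn b.
  apply: le_trans (hU b) _.
  rewrite {1}AE qf_diag -(sqn_isometry _ _ b _ UU).
  rewrite -(sqn_isometry _ _ (b *m U) V^T) ?trmxK // /sqn mulr_sumr.
  apply: ler_sum => -[i ip] _; rewrite [(\row_i _) _ _]mxE.
  have [id|di] := ltnP i d; first by rewrite hx // expr0n /= !mulr0.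
  by rewrite ler_wpM2r ?sqr_ge0 // eigs_nonincr // di ip.
by rewrite ler_pM2r // sqn_gt0.
Qed.

Lemma qf_row_orthodiag (V : 'M[R]_p) (D b : 'rV[R]_p) : V *m V^T = 1%:M ->
  qf (V^T *m diag_mx D *m V) (b *m V) = \sum_i D ord0 i * b ord0 i ^+ 2.
Proof.
by move=> VV; rewrite qf_diag -mulmxA VV mulmx1.
Qed.

(* Ky Fan's minimum principle. *)
Lemma sum_eigs_le A (V : 'M[R]_p) (d : nat) : A^T = A -> V *m V^T = 1%:M ->
  (0 < d <= p)%N ->
  \sum_(i < p | (d <= i)%N) (eigs A)`_i <=
  \sum_(i < p | (d <= i)%N) qf A (row i V).
Proof.
move=> symA VV /andP[d0 dp]; have [E [EE AE]] := eigs_orthodiag _ symA.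
have [W WE] : exists W, W = V *m E^T by eexists.
(* The threshold between the two groups of eigenvalues. The weight differences below sum to zero, so
   every eigenvalue may be replaced by [l], which lowers each term. *)
pose l := (eigs A)`_d.-1.
have WW : W *m W^T = 1%:M.
  by rewrite WE trmx_mul trmxK mulmxA -(mulmxA V) (mulmx1C EE) mulmx1.
have WtW := mulmx1C WW.
have rowW j : \sum_(i < p) W j i ^+ 2 = 1.
  have /matrixP/(_ j j) := WW; rewrite !mxE eqxx /= => h.
  by rewrite -[RHS]h; apply: eq_bigr => i _; rewrite mxE expr2.
have colW i : \sum_(j < p) W j i ^+ 2 = 1.
  have /matrixP/(_ i i) := WtW; rewrite !mxE eqxx /= => h.
  by rewrite -[RHS]h; apply: eq_bigr => j _; rewrite mxE expr2.
(* The squared length of the projection of the [i]-th eigenvector of [A] on the span of the rows of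
   [V] from index [d] on: it lies in [0, 1], and the total is [p - d]. *)
pose h (i : 'I_p) := \sum_(j < p | (d <= j)%N) W j i ^+ 2.
have h1 i : h i <= 1.
  rewrite -(colW i) [leRHS](bigID (fun j : 'I_p => d <= j)%N) /=.
  by rewrite lerDl sumr_ge0 // => j _; rewrite sqr_ge0.
have h0 i : 0 <= h i by apply: sumr_ge0 => j _; rewrite sqr_ge0.
have sumh : \sum_i h i = \sum_(i < p | (d <= i)%N) 1.
  by rewrite /h exchange_big /=; apply: eq_bigr => j _; rewrite rowW.
have -> : \sum_(i < p | (d <= i)%N) qf A (row i V) = \sum_(i < p) (eigs A)`_i * h i.
  under eq_bigr => j _.
    rewrite {1}AE qf_diag -row_mul -WE.
    under eq_bigr => i _ do rewrite !mxE.
    over.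
  by rewrite exchange_big /=; apply: eq_bigr => i _; rewrite /h mulr_sumr.
have -> : \sum_(i < p | (d <= i)%N) (eigs A)`_i =
    \sum_(i < p) (eigs A)`_i * (d <= i)%N%:R.
  rewrite big_mkcond; apply: eq_bigr => i _.
  by case: ifP; rewrite ?mulr1 ?mulr0.
rewrite -subr_ge0 -sumrB.
have l0 : \sum_(i < p) l * (h i - (d <= i)%N%:R) = 0.
  rewrite -mulr_sumr sumrB sumh big_mkcond -sumrB big1 ?mulr0 // => i _.
  by case: ifP; rewrite subrr.
rewrite -[leLHS]l0.
apply: ler_sum => i _; rewrite -mulrBr.
have [di|id] := leqP d i.
- apply: ler_wnM2r; first by rewrite subr_le0.
  apply: eigs_nonincr => //; rewrite ltn_ord andbT.
  exact: leq_trans (leq_pred _) di.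
- apply: ler_wpM2r; first by rewrite subr0.
  by apply: eigs_nonincr => //; rewrite prednK // dp andbT -ltnS prednK.
Qed.

Lemma eigs_ge0 A i : A^T = A -> (forall a, 0 <= qf A a) -> 0 <= (eigs A)`_i.
Proof.
move=> symA posA; have [ip|pi] := ltnP i p; last first.
  by rewrite nth_default // size_eigs.
have [V [VV AE]] := eigs_orthodiag _ symA.
have := posA (delta_mx ord0 (Ordinal ip) *m V).
rewrite {1}AE qf_row_orthodiag // (bigD1 (Ordinal ip)) //= big1.
  by rewrite !mxE !eqxx expr1n mulr1 addr0.
by move=> j ji; rewrite !mxE eqxx (negbTE ji) expr0n /= mulr0.
Qed.

(** One side of Weyl's inequality. The span of the first [i.+1] eigenvectors of [B] is a test space
    for [eigs_nth_ge]: on it the form of [B] is at least its [i]-th eigenvalue, and the form of [A]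
    is at most [e] lower. *)
Lemma eigs_lipschitz_half A B (e : R) i : A^T = A -> B^T = B ->
  (forall a, `|qf A a - qf B a| <= e * sqn a) -> (i < p)%N ->
  (eigs B)`_i - e <= (eigs A)`_i.
Proof.
move=> symA symB AB ip; have [V [VV BE]] := eigs_orthodiag _ symB.
pose f : 'I_i.+1 -> 'I_p := widen_ord ip.
have finj : injective f by move=> x y /(congr1 val) /= xy; exact: val_inj.
pose U := rowsub f V.
have UE : U = rowsub f 1%:M *m V by rewrite mul_rowsub_mx mul1mx.
have UU : U *m U^T = 1%:M by exact: rowsub_orthonormal.
apply: (@eigs_nth_ge _ _ U) => // b; rewrite mulrBl lerBlDr.
have := AB (b *m U); rewrite ler_norml => /andP[h _].
have {}h : qf B (b *m U) - e * sqn b <= qf A (b *m U).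
  by move: h; rewrite (sqn_isometry _ _ _ _ UU); lra.
suff : (eigs B)`_i * sqn b <= qf B (b *m U) by lra.
rewrite [in leRHS]BE UE mulmxA qf_row_orthodiag //.
have -> : sqn b = sqn (b *m rowsub f 1%:M).
  rewrite sqn_isometry //.
  by move: UU; rewrite UE trmx_mul mulmxA -(mulmxA _ V) VV mulmx1.
rewrite /sqn mulr_sumr; apply: ler_sum => j _; rewrite [(\row__ _) _ _]mxE.
have [ji|ij] := leqP j i; first by rewrite ler_wpM2r ?sqr_ge0 ?eigs_nonincr ?ji.
suff -> : (b *m rowsub f 1%:M) ord0 j = 0 by rewrite expr0n /= !mulr0.
rewrite mxE big1 // => x _; rewrite !mxE.
have /negbTE -> : f x != j by apply/eqP => /(congr1 val) /= xj;
  have := ltn_ord x; rewrite -xj in ij; rewrite ltnNge ij.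
by rewrite mulr0.
Qed.

Lemma eigs_lipschitz A B (e : R) i : A^T = A -> B^T = B ->
  (forall a, `|qf A a - qf B a| <= e * sqn a) -> (i < p)%N ->
  `|(eigs A)`_i - (eigs B)`_i| <= e.
Proof.
move=> symA symB AB ip.
have h1 := eigs_lipschitz_half _ _ _ _ symA symB AB ip.
have h2 : (eigs A)`_i - e <= (eigs B)`_i.
  by apply: eigs_lipschitz_half => // a; rewrite distrC.
by rewrite ler_norml; apply/andP; split; lra.
Qed.

(** From [|x y| <= (x^2 + y^2) / 2], each squared coordinate being counted [p] times in all. *)
Lemma qf_dist A B (e : R) (a : 'rV[R]_p) :
  (forall i j, `|A i j - B i j| <= e) -> `|qf A a - qf B a| <= e * p%:R * sqn a.
Proof.
move=> AB.
have -> : qf A a - qf B a =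
    \sum_i \sum_j (A i j - B i j) * (a ord0 i * a ord0 j).
  rewrite /qf !mxE -sumrB exchange_big; apply: eq_bigr => j _ /=.
  rewrite !mxE -mulrBl -sumrB mulr_suml; apply: eq_bigr => i _; ring.
apply: le_trans (ler_norm_sum _ _ _) _.
have -> : e * p%:R * sqn a =
    \sum_(i < p) \sum_(j < p) e * ((a ord0 i ^+ 2 + a ord0 j ^+ 2) / 2).
  under eq_bigr => i _ do rewrite -mulr_sumr -mulr_suml big_split /= sumr_const card_ord -/(sqn a).
  rewrite -mulr_sumr -mulr_suml big_split /= sumr_const card_ord sumrMnl -/(sqn a).
  by rewrite -mulr_natl; field.
apply: ler_sum => i _; apply: le_trans (ler_norm_sum _ _ _) _.
apply: ler_sum => j _; rewrite normrM; apply: ler_pM => //.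
set x := a _ i; set y := a _ j.
have := sqr_ge0 (x + y); have := sqr_ge0 (x - y).
by rewrite sqrrB sqrrD ler_norml => hm hp; apply/andP; split; lra.
Qed.

End Eigs.

(** * Measurability of the statistic *)

Lemma measurable_le_cst (R : realType) (dT : measure_display)
    (T : measurableType dT) (f : T -> R) (c : R) :
  measurable_fun setT f -> measurable [set t | f t <= c].
Proof.
move=> mf; rewrite -[X in measurable X]setTI.
exact: (measurable_fun_le measurableT mf (measurable_cst _)).
Qed.

Lemma measurable_ge_cst (R : realType) (dT : measure_display)
    (T : measurableType dT) (f : T -> R) (c : R) :
  measurable_fun setT f -> measurable [set t | c <= f t].
Proof.
move=> mf; rewrite -[X in measurable X]setTI.
exact: (measurable_fun_le measurableT (measurable_cst _) mf).
Qed.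

(** Inversion is continuous off 0, and any function is measurable on the single point 0. *)
Lemma measurable_funV (R : realType) (dT : measure_display)
    (T : measurableType dT) (f : T -> R) :
  measurable_fun setT f -> measurable_fun setT (fun t => (f t)^-1).
Proof.
move=> mf; suff mi : measurable_fun setT (fun x : R => x^-1).
  exact: (measurableT_comp mi mf).
have -> : [set: R] = [set 0] `|` ~` [set 0] by rewrite setUv.
apply/measurable_funU => //; first exact: measurableC.
split; first exact: measurable_fun_set1.
apply: open_continuous_measurable_fun.
  apply: closed_openC; apply: accessible_closed_set1.
  by apply: hausdorff_accessible; exact: Rhausdorff.
by move=> x; rewrite inE => /eqP x0; exact: inv_continuous.
Qed.

(** [F] may be arbitrary: integer matrices are countable, so each preimage is a countable union of
    preimages of half-open boxes. *)
Lemma measurable_comp_floor (R : realType) (dT : measure_display)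
    (T : measurableType dT) (p : nat) (S : T -> 'M[R]_p) (F : 'M[int]_p -> R) :
  (forall j l, measurable_fun setT (fun t => S t j l)) ->
  measurable_fun setT (fun t => F (map_mx Num.floor (S t))).
Proof.
move=> mS _ Y mY; rewrite setTI.
have -> : (fun t => F (map_mx Num.floor (S t))) @^-1` Y =
    \bigcup_(K : 'M[int]_p) (if `[<Y (F K)>] then
      \bigcap_(jl : 'I_p * 'I_p)
        ((fun t => S t jl.1 jl.2) @^-1` `[(K jl.1 jl.2)%:~R, (K jl.1 jl.2 + 1)%:~R[)
      else set0).
  apply/seteqP; split => t /=.
    move=> Yt; exists (map_mx Num.floor (S t)) => //.
    case: asboolP => // _ -[j l] _ /=.
    by rewrite in_itv /= mxE floor_le floorD1_gt.
  move=> [K _]; case: asboolP => // YK h.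
  suff -> : map_mx Num.floor (S t) = K by [].
  apply/matrixP => j l; rewrite mxE; apply/eqP; rewrite floor_eq.
  by have := h (j, l) I; rewrite /= in_itv.
apply: countable_bigcupT_measurable => [|K]; first exact: countableP.
case: asboolP => // _; apply: fin_bigcap_measurable => //.
move=> jl _; rewrite -[X in measurable X]setTI; exact: mS.
Qed.

(* [S t] is the limit of its roundings to the grids of mesh [1 / m.+1], which
   take countably many values, and the ordered eigenvalues are Lipschitz. *)
Lemma measurable_eigs (R : realType) (dT : measure_display)
    (T : measurableType dT) (p : nat) (S : T -> 'M[R]_p) (i : nat) :
  (forall t, (S t)^T = S t) ->
  (forall j l, measurable_fun setT (fun t => S t j l)) ->
  measurable_fun setT (fun t => (eigs (S t))`_i).
Proof.
move=> symS mS; have [ip|pi] := ltnP i p; last first.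
  rewrite (_ : (fun _ => _) = cst 0) //.
  by apply/funext => t; rewrite nth_default // size_eigs.
pose h (m : nat) (K : 'M[int]_p) : 'M[R]_p := \matrix_(j, l) ((K j l)%:~R / m.+1%:R).
pose Sm (m : nat) t := h m (map_mx Num.floor (m.+1%:R *: S t)).
apply: (@measurable_fun_cvg _ _ _ _ (fun m t => (eigs (Sm m t))`_i)).
  move=> m; apply: (measurable_comp_floor _ _ _ _ (fun t => m.+1%:R *: S t)
    (fun K => (eigs (h m K))`_i)) => j l.
  under eq_fun => t do rewrite mxE.
  exact: measurable_funM.
move=> t _.
have hS m j l : `|S t j l - Sm m t j l| <= m.+1%:R^-1.
  rewrite !mxE; set x := S t j l; set f := Num.floor _.
  have m0 : 0 < m.+1%:R :> R by [].
  have f1 : f%:~R <= m.+1%:R * x by exact: floor_le.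
  have f2 : m.+1%:R * x < (f + 1)%:~R by exact: floorD1_gt.
  have -> : x - f%:~R / m.+1%:R = (m.+1%:R * x - f%:~R) / m.+1%:R.
    by field; rewrite gt_eqF.
  rewrite normrM [`|_^-1|]ger0_norm ?invr_ge0 ?(ltW m0) //.
  rewrite -[leRHS]mul1r ler_wpM2r ?invr_ge0 ?(ltW m0) //.
  rewrite intrD in f2; rewrite ler_norml; apply/andP; split; lra.
have symSm m : (Sm m t)^T = Sm m t.
  by apply/matrixP => j l; rewrite !mxE -{1}symS mxE.
have bound m : `|(eigs (S t))`_i - (eigs (Sm m t))`_i| <= m.+1%:R^-1 * p%:R.
  by apply: eigs_lipschitz => // a; exact: qf_dist.
apply/cvgrPdist_le => e e0; near=> m.
apply: le_trans (bound m) _.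
rewrite mulrC ler_pdivrMr // -ler_pdivrMl //.
near: m.
apply: filterS (nbhs_infty_ger (e^-1 * p%:R)) => m /le_trans; apply.
by rewrite ler_nat.
Unshelve. all: by end_near.
Qed.

Lemma sample_cov_sym {R : realType} {n p : nat} (x : 'I_n -> 'I_p -> R) :
  (sample_cov x)^T = sample_cov x.
Proof.
apply/matrixP => j l; rewrite !mxE; congr (_ * _).
by apply: eq_bigr => i _; rewrite mulrC.
Qed.

Lemma measurable_g_stat (R : realType) (dT : measure_display)
    (T : measurableType dT) (n p k : nat) (x : T -> 'I_n -> 'I_p -> R) :
  (forall i j, measurable_fun setT (fun t => x t i j)) ->
  measurable_fun setT (fun t => g_stat k (x t)).
Proof.
move=> mx.
have mS j l : measurable_fun setT (fun t => sample_cov (x t) j l).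
  under eq_fun => t do rewrite mxE /sample_mean.
  apply: measurable_funM => //; apply: measurable_sum => i.
  by apply: measurable_funM; apply: measurable_funB => //;
    apply: measurable_funM => //; exact: measurable_sum.
have symS t : (sample_cov (x t))^T = sample_cov (x t) by exact: sample_cov_sym.
have mmom l r : measurable_fun setT (fun t => mom l r (sample_cov (x t))).
  rewrite /mom.
  (* The tail of the eigenvalue list is indexed by a range independent of [t]. Its length is
     [p - (p - r)], which differs from [r] when [r > p]. *)
  have -> : (fun t => r%:R^-1 * \sum_(c <- drop (p - r) (eigs (sample_cov (x t)))) c ^+ l) =
     (fun t => r%:R^-1 * \sum_(i <- iota 0 (p - (p - r))) (eigs (sample_cov (x t)))`_(p - r + i) ^+ l).
    apply/funext => t; congr (_ * _).
    rewrite (big_nth 0) size_drop size_eigs // /index_iota subn0.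
    by apply: eq_bigr => i _; rewrite nth_drop.
  apply: measurable_funM => //; apply: measurable_sum => i.
  by apply: measurable_funX; exact: measurable_eigs.
rewrite /g_stat /T_stat.
apply: measurable_funB => //; apply: measurable_funM => //.
apply: measurable_funB => //; apply: measurable_funM => //.
by apply: measurable_funV; exact: measurable_funX.
Qed.

(** * Crude bounds on normal distributions *)

Section Density.
Local Open Scope ereal_scope.
Context (dT : measure_display) (T : measurableType dT) (R : realType).
Variables (mu nu : {measure set T -> \bar R}) (h : T -> \bar R).
Hypothesis mh : measurable_fun setT h.
Hypothesis h0 : forall x, 0 <= h x.
Hypothesis hfin : forall x, h x \is a fin_num.
Hypothesis nuE : forall A, measurable A -> nu A = \int[mu]_(x in A) h x.

Import HBNNSimple.

Lemma integral_density_nnsfun (g : {nnsfun T >-> R}) :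
  \int[nu]_x (g x)%:E = \int[mu]_x ((g x)%:E * h x).
Proof.
under [LHS]eq_integral do rewrite fimfunE -fsumEFin//.
rewrite [LHS]ge0_integral_fsum//; last 2 first.
  - by move=> r; exact/measurable_EFinP/measurableT_comp.
  - by move=> n x _; rewrite EFinM nnfun_muleindic_ge0.
under [RHS]eq_integral.
  move=> x xD; rewrite fimfunE -fsumEFin// ge0_mule_fsuml; last first.
    by move=> r; rewrite EFinM nnfun_muleindic_ge0.
  over.
rewrite [RHS]ge0_integral_fsum//; last 2 first.
  - move=> r; apply: emeasurable_funM => //.
    exact/measurable_EFinP/measurableT_comp.
  - by move=> r x _; rewrite mule_ge0 // EFinM nnfun_muleindic_ge0.
apply: eq_fsbigr => r _.
rewrite integralZl_indic_nnsfun// integral_indic// setIT nuE//.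
(* A negative level has an empty preimage, so only nonnegative scalars are moved through the
   integral. *)
have [r0|r0] := leP 0%R r; last first.
  rewrite preimage_nnfun0 // integral_set0 mule0; apply/esym/integral0_eq => x _.
  by rewrite indic0 mulr0 mul0e.
rewrite integral_mkcond /= -ge0_integralZl//; last 2 first.
  - by apply/(measurable_restrictT _ _).1 => //; exact: measurable_funS mh.
  - by move=> x _; rewrite patchE; case: ifP.
apply: eq_integral => x _; rewrite patchE indicE.
by case: ifP => _; rewrite ?mulr1 // mule0 mulr0 mul0e.
Qed.

(** Monotone convergence on both sides along simple functions increasing to [f]. *)
Lemma ge0_integral_density (f : T -> \bar R) : measurable_fun setT f ->
  (forall x, 0 <= f x) -> \int[nu]_x f x = \int[mu]_x (f x * h x).
Proof.
move=> mf f0.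
pose f_ := nnsfun_approx measurableT mf.
transitivity (lim (\int[nu]_x (f_ n x)%:E @[n --> \oo])).
  rewrite -monotone_convergence//=.
  - apply: eq_integral => ? /[!inE] xD; apply/esym/cvg_lim => //=.
    exact: cvg_nnsfun_approx.
  - by move=> n; exact/measurable_EFinP/measurable_funTS.
  - by move=> n ? _; rewrite lee_fin.
  - by move=> ? _ ? ? mn; rewrite lee_fin; exact/lefP/nd_nnsfun_approx.
transitivity (lim (\int[mu]_x ((f_ n x)%:E * h x) @[n --> \oo])).
  by apply: congr_lim; apply/funext => n /=; exact: integral_density_nnsfun.
rewrite -monotone_convergence//=.
- apply: eq_integral => x /[!inE] xD; apply/cvg_lim => //=.
  apply: cvgeZr => //.
  exact: cvg_nnsfun_approx.
- move=> n; apply: emeasurable_funM => //.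
  exact/measurable_EFinP/measurable_funTS.
- by move=> n x _; rewrite mule_ge0 // lee_fin.
- move=> x _ a b ab; apply: lee_wpmul2r => //.
  by rewrite lee_fin; exact/lefP/nd_nnsfun_approx.
Qed.

End Density.

(** * Second moment and tail mass of a normal law *)

Section NormalBounds.
Context {R : realType}.
Implicit Types m s : R.

Lemma normal_peak_double s : 0 < s -> normal_peak s = 2 * normal_peak (2 * s).
Proof.
move=> s0; rewrite /normal_peak.
have -> : (2 * s) ^+ 2 * pi *+ 2 = 2 ^+ 2 * (s ^+ 2 * pi *+ 2) :> R by ring.
by rewrite sqrtrM ?exprn_ge0 // sqrtr_sqr ger0_norm // invfM mulrA divff ?mul1r.
Qed.

(** Domination by the density of twice the standard deviation: the second moment is then bounded
    using only that a density has integral 1. The constant 6 is not sharp. *)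
Lemma sqr_normal_pdf_le m s x : 0 < s ->
  (x - m) ^+ 2 * normal_pdf m s x <= 6 * s ^+ 2 * normal_pdf m (2 * s) x.
Proof.
move=> s0; rewrite !normal_pdfE ?mulf_neq0 ?gt_eqF //.
rewrite normal_peak_double // /normal_fun.
set y := x - m; set c := normal_peak _.
have c0 : 0 <= c by exact: normal_peak_ge0.
(* The gap between the two Gaussian exponents. Then [y^2 <= 3 s^2 (1 + u) <= 3 s^2 exp u]. *)
pose u := 3 * y ^+ 2 / (8 * s ^+ 2).
have s20 : 0 < s ^+ 2 by rewrite exprn_gt0.
have -> : - y ^+ 2 / ((2 * s) ^+ 2 *+ 2) = - y ^+ 2 / (s ^+ 2 *+ 2) + u.
  by rewrite /u; field; rewrite gt_eqF.
rewrite expRD; set E := expR (- y ^+ 2 / (s ^+ 2 *+ 2)).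
have E0 : 0 <= E by exact: expR_ge0.
have hu : y ^+ 2 <= 3 * s ^+ 2 * expR u.
  apply: (@le_trans _ _ (3 * s ^+ 2 * (1 + u))).
    rewrite /u; have -> : 3 * s ^+ 2 * (1 + 3 * y ^+ 2 / (8 * s ^+ 2)) =
      3 * s ^+ 2 + 9 / 8 * y ^+ 2 by field; rewrite gt_eqF.
    by have := sqr_ge0 y; lra.
  by rewrite ler_wpM2l ?expR_ge1Dx // mulr_ge0 // ltW.
have -> : 6 * s ^+ 2 * (c * (E * expR u)) = 3 * s ^+ 2 * expR u * (2 * c * E) by ring.
by apply: ler_wpM2r hu; rewrite !mulr_ge0.
Qed.

Lemma normal_prob_variance_le m s : 0 < s ->
  (\int[normal_prob m s]_x ((x - m) ^+ 2)%:E <= (6 * s ^+ 2)%:E)%E.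
Proof.
move=> s0.
have mpdf t : measurable_fun setT (fun x => (normal_pdf m t x)%:E).
  by apply/measurable_EFinP; exact: measurable_normal_pdf.
have pdf0 t x : (0 <= (normal_pdf m t x)%:E)%E by rewrite lee_fin normal_pdf_ge0.
have msq : measurable_fun setT (fun x : R => ((x - m) ^+ 2)%:E).
  by apply/measurable_EFinP/measurable_funX; exact: measurable_funB.
rewrite (@ge0_integral_density _ _ _ lebesgue_measure _ _ (mpdf s) (pdf0 s) _ _) //; last first.
  by move=> x; rewrite lee_fin sqr_ge0.
apply: (@le_trans _ _ (\int[lebesgue_measure]_x ((6 * s ^+ 2)%:E * (normal_pdf m (2 * s) x)%:E)))%E.
  apply: ge0_le_integral => //=.
  - by move=> x _; rewrite mule_ge0 // lee_fin sqr_ge0.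
  - by apply: emeasurable_funM; [exact: msq|exact: mpdf].
  - by apply: emeasurable_funM; [exact: measurable_cst|exact: mpdf].
  - by move=> x _; rewrite -!EFinM lee_fin sqr_normal_pdf_le.
rewrite ge0_integralZl //; last by rewrite lee_fin mulr_ge0 // sqr_ge0.
  by rewrite integral_normal_pdf mule1.
exact: mpdf.
Qed.

(* A lower bound for the mass that N(m, s^2) gives to [m + s, m + 2 s]. *)
Definition tail_mass : R := expR (-2) * (Num.sqrt (pi *+ 2))^-1.

Lemma tail_mass_gt0 : 0 < tail_mass.
Proof.
by rewrite mulr_gt0 ?expR_gt0 // invr_gt0 sqrtr_gt0 mulrn_wgt0 // pi_gt0.
Qed.

(** Within [2 * s] of the mean the density is at least [tail_mass / s], and the interval has length
    [s]. *)
Lemma normal_prob_itv_ge m s a b (A : set R) : 0 < s -> b - a = s ->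
  (forall x, a <= x <= b -> (x - m) ^+ 2 <= (2 * s) ^+ 2) ->
  measurable A -> `[a, b]%classic `<=` A -> (tail_mass%:E <= normal_prob m s A)%E.
Proof.
move=> s0 bas hx mA abA; rewrite /normal_prob.
have ab : a < b by rewrite -subr_gt0 bas.
have mpdf : measurable_fun setT (fun x => (normal_pdf m s x)%:E).
  by apply/measurable_EFinP; exact: measurable_normal_pdf.
apply: (@le_trans _ _ (\int[lebesgue_measure]_(x in `[a, b]) (normal_pdf m s x)%:E))%E; last first.
  apply: ge0_subset_integral => //.
  - by apply: measurable_funTS; exact: mpdf.
  - by move=> x _; rewrite lee_fin normal_pdf_ge0.
apply: (@le_trans _ _ (\int[lebesgue_measure]_(x in `[a, b]) (tail_mass / s)%:E))%E.
  rewrite integral_cst//= lebesgue_measure_itv/= lte_fin ab -EFinD -EFinM lee_fin.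
  by rewrite bas divfK // gt_eqF.
apply: ge0_le_integral => //=.
- by move=> x _; rewrite lee_fin divr_ge0 // ltW // tail_mass_gt0.
- by apply: measurable_funTS; exact: mpdf.
move=> x; rewrite in_itv /= => xab; rewrite lee_fin normal_pdfE ?gt_eqF //.
have pk : normal_peak s = (Num.sqrt (pi *+ 2))^-1 / s.
  rewrite /normal_peak -mulrnAr sqrtrM ?sqr_ge0 // sqrtr_sqr ger0_norm ?ltW //.
  by rewrite invfM mulrC.
rewrite pk /tail_mass -mulrA mulrC; apply: ler_wpM2l.
  by rewrite divr_ge0 // ?invr_ge0 ?sqrtr_ge0 // ltW.
rewrite ler_expR mulNr lerN2 ler_pdivrMr; last by rewrite mulrn_wgt0 // exprn_gt0.
by apply: le_trans (hx _ xab) _; rewrite exprMn; lra.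
Qed.

Lemma measurable_ge (a : R) : measurable [set x | a <= x]%R.
Proof.
rewrite (_ : [set x | a <= x]%R = `[a, +oo[%classic) //.
by apply/seteqP; split => x /=; rewrite in_itv /= andbT.
Qed.

Lemma measurable_le (a : R) : measurable [set x | x <= a]%R.
Proof.
by rewrite (_ : [set x | x <= a]%R = `]-oo, a]%classic).
Qed.

Lemma normal_prob_right_tail m s : 0 < s ->
  (tail_mass%:E <= normal_prob m s [set x | m + s <= x]%R)%E.
Proof.
move=> s0; apply: (@normal_prob_itv_ge _ _ (m + s) (m + 2 * s)) => //.
- ring.
- by move=> x /andP[h1 h2]; rewrite ler_sqr ?nnegrE; lra.
- exact: measurable_ge.
- by move=> x /=; rewrite in_itv /= => /andP[].
Qed.

Lemma normal_prob_left_tail m s : 0 < s ->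
  (tail_mass%:E <= normal_prob m s [set x | x <= m - s]%R)%E.
Proof.
move=> s0; apply: (@normal_prob_itv_ge _ _ (m - 2 * s) (m - s)) => //.
- ring.
- by move=> x /andP[h1 h2]; rewrite -sqrrN ler_sqr ?nnegrE; lra.
- exact: measurable_le.
- by move=> x /=; rewrite in_itv /= => /andP[].
Qed.

End NormalBounds.

(** * Linear forms of a Gaussian sample *)

Section Probability.
Context {R : realType} {dT : measure_display} {T : measurableType dT}.
Context (P : probability T R).

Lemma markov_ge0 (f : T -> R) (K C : R) : measurable_fun setT f ->
  (forall t, 0 <= f t) -> 0 < K -> (\int[P]_t (f t)%:E <= C%:E)%E ->
  (P [set t | K <= f t]%R <= (C / K)%:E)%E.
Proof.
move=> mf f0 K0 hC.
have mA : measurable [set t | K <= f t]%R by exact: measurable_ge_cst.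
rewrite EFinM muleC -lee_pdivrMl ?invr_gt0 // invrK.
apply: le_trans hC.
have -> : P [set t | K <= f t]%R = (\int[P]_t (\1_[set t | K <= f t]%R t)%:E)%E.
  by rewrite integral_indic // setIT.
rewrite -ge0_integralZl //; last 2 first.
- exact/measurable_EFinP/measurable_indic.
- by rewrite lee_fin ltW.
apply: ge0_le_integral => //=.
- by move=> t _; rewrite -EFinM lee_fin mulr_ge0 // ltW.
- by apply: emeasurable_funM => //; exact/measurable_EFinP/measurable_indic.
- exact/measurable_EFinP.
- move=> t _; rewrite -EFinM lee_fin indicE.
  by case: (boolP (_ \in _)) => [|_]; rewrite ?inE /= ?mulr1 ?mulr0.
Qed.

(** Dynkin's pi-lambda theorem: the measurable events independent of [E] form a lambda-system
    containing the pi-system [G]. *)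
Lemma indep_g_sigma_algebra (G : set (set T)) (E : set T) : setI_closed G ->
  (forall F, G F -> measurable F) -> measurable E ->
  (forall F, G F -> P (F `&` E) = (P F * P E)%E) ->
  forall F, <<s G >> F -> P (F `&` E) = (P F * P E)%E.
Proof.
move=> GI mG mE GE F sF.
suff : <<s G >> `<=` [set A | measurable A /\ P (A `&` E) = (P A * P E)%E].
  by move=> /(_ _ sF) [].
apply: lambda_system_subset => //.
- apply/dynkin_lambda_system; split => /=.
  + by split => //; rewrite setTI probability_setT mul1e.
  + move=> A [mA AE]; split; first exact: measurableC.
    have hD : P (E `\` A) = (P E - P (E `&` A))%E.
      by rewrite measureD // ltey_eq fin_num_measure.
    rewrite setIC -setDE hD.
    rewrite (setIC E A) AE probability_setC // muleBl ?fin_num_measure //.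
    by rewrite mul1e.
  + move=> A tA hA.
    have mA k : measurable (A k) by have [] := hA k.
    split; first exact: bigcup_measurable.
    rewrite setI_bigcupl measure_bigcup //=; last 2 first.
      by move=> k _; exact: measurableI.
      exact: trivIset_setIr.
    have PE : P E = (fine (P E))%:E by rewrite fineK // fin_num_measure.
    rewrite measure_bigcup // muleC PE -nneseriesZl //.
    by apply: eq_eseriesr => k _; have [_ ->] := hA k; rewrite muleC -PE.
- by move=> A GA; split; [exact: mG|exact: GE].
Qed.

(** Chebyshev's inequality: the count has mean [s >= q n] and, by pairwise independence, variance at
    most [n], so falling to [q n / 2] means a deviation of at least [q n / 2]. *)
Lemma count_lower_tail (n : nat) (A : 'I_n -> set T) (q : R) :
  (forall i, measurable (A i)) ->
  (forall i j, i != j -> P (A i `&` A j) = (P (A i) * P (A j))%E) ->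
  0 < q -> (forall i, q%:E <= P (A i))%E -> (0 < n)%N ->
  (P [set t | \sum_(i < n) \1_(A i) t <= q * n%:R / 2]%R <=
   (4 / (q ^+ 2 * n%:R))%:E)%E.
Proof.
move=> mA indA q0 qA n0.
pose r i := fine (P (A i)).
have PA i : P (A i) = (r i)%:E by rewrite /r fineK // fin_num_measure.
have r0 i : 0 <= r i by rewrite -lee_fin -PA.
have qr i : q <= r i by rewrite -lee_fin -PA.
pose s := \sum_(i < n) r i.
have s0 : 0 <= s by apply: sumr_ge0.
pose N t : R := \sum_(i < n) \1_(A i) t.
have N0 t : 0 <= N t by apply: sumr_ge0.
have mN : measurable_fun setT N.
  by apply: measurable_sum => i; exact: measurable_indic.
pose Z t := (N t - s) ^+ 2.
have mZ : measurable_fun setT Z.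
  by apply: measurable_funX; exact: measurable_funB.
have Z0 t : 0 <= Z t by exact: sqr_ge0.
have intI B : measurable B -> (\int[P]_t (\1_B t)%:E = P B)%E.
  by move=> mB; rewrite integral_indic // setIT.
have intN : (\int[P]_t (N t)%:E = s%:E)%E.
  under eq_integral => t _ do rewrite /N -sumEFin.
  rewrite ge0_integral_sum //; last by move=> i; exact/measurable_EFinP/measurable_indic.
  rewrite /s -sumEFin; apply: eq_bigr => i _.
  by rewrite intI.
(* The square is a sum over pairs: off the diagonal the probabilities factor, and each of the [n]
   diagonal terms is at most 1. *)
have intNN : (\int[P]_t (N t ^+ 2)%:E <= (s ^+ 2 + n%:R)%:E)%E.
  have -> : (fun t => (N t ^+ 2)%:E) = (fun t =>
      \sum_(ij : 'I_n * 'I_n) (\1_(A ij.1 `&` A ij.2) t)%:E)%E.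
    apply/funext => t; rewrite sumEFin; congr EFin.
    rewrite expr2 /N mulr_suml -(pair_bigA _ (fun i j => \1_(A i `&` A j) t)) /=.
    apply: eq_bigr => i _; rewrite mulr_sumr; apply: eq_bigr => j _.
    by rewrite indicI.
  rewrite ge0_integral_sum //; last first.
    by move=> [i j]; apply/measurable_EFinP/measurable_indic; exact: measurableI.
  apply: (@le_trans _ _ (\sum_(ij : 'I_n * 'I_n) (r ij.1 * r ij.2 + (ij.1 == ij.2)%:R)%:E)%E).
    apply: lee_sum => -[i j] _ /=; rewrite intI; last exact: measurableI.
    have [<-|ij] := eqVneq i j.
      rewrite setIid PA lee_fin.
      have : r i <= 1 by rewrite -lee_fin -PA probability_le1.
      by move=> r1; rewrite (le_trans r1) // lerDr mulr_ge0.
    by rewrite addr0 indA // !PA.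
  rewrite sumEFin lee_fin big_split /= lerD //.
    rewrite -(pair_bigA _ (fun i j => r i * r j)) /= expr2 /s mulr_suml.
    by apply: ler_sum => i _; rewrite mulr_sumr.
  rewrite -(pair_bigA _ (fun i j : 'I_n => (i == j)%:R)) /=.
  rewrite (eq_bigr (fun=> 1)); first by rewrite sumr_const card_ord.
  move=> i _; rewrite (bigD1 i) //= eqxx big1 ?addr0 // => j ji.
  by rewrite eq_sym (negbTE ji).
have intZ : (\int[P]_t (Z t)%:E <= n%:R%:E)%E.
  (* The expansion of [(N - s)^2] with its negative term moved across, so that only integrals of
     nonnegative functions occur. *)
  have h : (\int[P]_t (Z t)%:E + (2 * s)%:E * \int[P]_t (N t)%:E =
      \int[P]_t (N t ^+ 2)%:E + (s ^+ 2)%:E)%E.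
    rewrite -ge0_integralZl //; last 3 first.
    - exact/measurable_EFinP.
    - by move=> t _; rewrite lee_fin.
    - by rewrite lee_fin mulr_ge0.
    rewrite -ge0_integralD //; last 4 first.
    - by move=> t _; rewrite lee_fin.
    - exact/measurable_EFinP.
    - by move=> t _; rewrite -EFinM lee_fin !mulr_ge0.
    - by apply: emeasurable_funM => //; exact/measurable_EFinP.
    have -> : ((s ^+ 2)%:E = \int[P]_t (cst (s ^+ 2)%:E t))%E.
      transitivity ((s ^+ 2)%:E * P setT)%E; last by rewrite integral_cst.
      by rewrite probability_setT mule1.
    rewrite -ge0_integralD //; last 3 first.
    - by move=> t _; rewrite lee_fin sqr_ge0.
    - by apply/measurable_EFinP/measurable_funX.
    - by move=> t _; rewrite lee_fin sqr_ge0.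
    apply: eq_integral => t _; rewrite /Z /= -EFinM -!EFinD; congr EFin; ring.
  rewrite intN in h.
  have : (\int[P]_t (Z t)%:E + (2 * s)%:E * s%:E <= (s ^+ 2 + n%:R)%:E + (s ^+ 2)%:E)%E.
    by rewrite h leeD2r.
  rewrite -EFinM -EFinD -leeBrDr // -EFinB => /le_trans; apply.
  by rewrite lee_fin; lra.
have qn0 : 0 < q * n%:R / 2 by rewrite !mulr_gt0 // ltr0n.
have := markov_ge0 Z ((q * n%:R / 2) ^+ 2) n%:R mZ Z0 (exprn_gt0 2 qn0) intZ.
have -> : n%:R / (q * n%:R / 2) ^+ 2 = 4 / (q ^+ 2 * n%:R).
  by field; rewrite pnatr_eq0 -lt0n n0 gt_eqF.
apply: le_trans; apply: le_measure; rewrite ?inE.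
- exact: measurable_le_cst.
- exact: measurable_ge_cst.
move=> t /=; rewrite -/(N t) /Z => hN.
have qs : q * n%:R <= s.
  rewrite mulr_natr -[n in _ *+ n]card_ord -sumr_const.
  exact: ler_sum.
by rewrite -[leRHS]sqrrN ler_sqr ?nnegrE; lra.
Qed.

End Probability.

(** * One-dimensional projections of the sample *)

Section Sample.
Context {R : realType} {dT : measure_display} {T : measurableType dT}.
Context {P : probability T R} {n p : nat} (mu : 'cV[R]_p) (Sig : 'M[R]_p).
Context (X : 'I_n -> 'I_p -> {RV P >-> R}).
Hypothesis HX : gaussian_sample mu Sig X.

Definition lin_form (a : 'rV[R]_p) (i : 'I_n) (t : T) : R :=
  \sum_(j < p) a ord0 j * X i j t.

Definition lin_mean (a : 'rV[R]_p) : R := \sum_(j < p) a ord0 j * mu j ord0.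

Lemma measurable_lin_form a i : measurable_fun setT (lin_form a i).
Proof. by apply: measurable_sum => j; exact: measurable_funM. Qed.

Lemma lin_normal a i (B : set R) : a != 0 -> measurable B ->
  P (lin_form a i @^-1` B) = normal_prob (lin_mean a) (Num.sqrt (qf Sig a)) B.
Proof.
move=> a0 mB; have [H1 _] := HX.
have ex : exists j, a ord0 j != 0.
  apply/existsP; apply: contraNT a0; rewrite negb_exists => /forallP h.
  by apply/eqP/rowP => j; rewrite mxE; have := h j; rewrite negbK => /eqP.
rewrite (H1 i (fun j => a ord0 j) ex B mB); congr (normal_prob _ (Num.sqrt _) _).
rewrite /qf mxE exchange_big /=; apply: eq_bigr => l _.
by rewrite !mxE mulr_suml.
Qed.

(** A pi-system generating the sigma-algebra of the [i]-th observation, made of the events to which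
    the product rule of [gaussian_sample] applies. *)
Definition rects (i : 'I_n) : set (set T) :=
  [set E | exists2 B : 'I_p -> set R, (forall j, measurable (B j)) &
    E = [set t | forall j, B j (X i j t)]].

Lemma measurable_rects i E : rects i E -> measurable E.
Proof.
move=> [B mB ->].
have -> : [set t | forall j, B j (X i j t)] = \bigcap_(j : 'I_p) (X i j @^-1` B j).
  by apply/seteqP; split => t /= h; [move=> j _; exact: h|move=> j; exact: h].
apply: fin_bigcap_measurable => // j _.
rewrite -[X in measurable X]setTI; exact: measurable_funPT.
Qed.

Lemma setI_closed_rects i : setI_closed (rects i).
Proof.
move=> _ _ [B mB ->] [C mC ->]; exists (fun j => B j `&` C j).
  by move=> j; exact: measurableI.
apply/seteqP; split => t /=; first by move=> [h1 h2] j; split.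
by move=> h; split => j; have [] := h j.
Qed.

(** In the product rule, all observations other than [i] and [i'] get the whole line, and their
    factors are 1. *)
Lemma indep_rects i i' E F : i != i' -> rects i E -> rects i' F ->
  P (E `&` F) = (P E * P F)%E.
Proof.
move=> ii [B mB ->] [C mC ->]; have [_ H2] := HX.
pose D k j := if k == i then B j else if k == i' then C j else setT.
have mD k j : measurable (D k j) by rewrite /D; case: ifP => // _; case: ifP.
have := H2 D mD.
have -> : [set t | forall k j, D k j (X k j t)] =
    [set t | forall j, B j (X i j t)] `&` [set t | forall j, C j (X i' j t)].
  apply/seteqP; split => t /=.
    move=> h; split => j.
      by have := h i j; rewrite /D eqxx.
    by have := h i' j; rewrite /D eqxx eq_sym (negbTE ii).
  move=> [h1 h2] k j; rewrite /D.
  by case: eqP => [->//|_]; case: eqP => [->//|].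
move=> ->; rewrite (bigD1 i) //= (bigD1 i') //= 1?eq_sym // big1 ?mule1.
  by congr (P _ * P _)%E; apply/seteqP; split => t /= h j; have := h j;
    rewrite /D ?eqxx // eq_sym (negbTE ii).
move=> k /andP[ki ki']; rewrite (_ : [set t | _] = setT) ?probability_setT //.
by apply/seteqP; split => t //= _ j; rewrite /D (negbTE ki) (negbTE ki').
Qed.

Lemma lin_g_sigma_algebra a i (B : set R) : measurable B ->
  <<s rects i >> (lin_form a i @^-1` B).
Proof.
move=> mB.
have mX j : measurable_fun setT (X i j : g_sigma_algebraType (rects i) -> R).
  move=> _ A mA; rewrite setTI; apply: sub_sigma_algebra.
  exists (fun k => if k == j then A else setT).
    by move=> k; case: ifP.
  apply/seteqP; split => t /=.
    by move=> h k; case: eqP => [->|].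
  by move=> /(_ j); rewrite eqxx.
have mY : measurable_fun setT (lin_form a i : g_sigma_algebraType (rects i) -> R).
  apply: measurable_sum => j; apply: measurable_funM => //.
by have := mY measurableT B mB; rewrite setTI.
Qed.

(** The product rule on rectangles is extended by the pi-lambda argument twice, once for each
    observation. *)
Lemma lin_indep a i i' (B C : set R) : i != i' -> measurable B -> measurable C ->
  P (lin_form a i @^-1` B `&` lin_form a i' @^-1` C) =
  (P (lin_form a i @^-1` B) * P (lin_form a i' @^-1` C))%E.
Proof.
move=> ii mB mC.
have mlC : measurable (lin_form a i' @^-1` C).
  by rewrite -[X in measurable X]setTI; exact: measurable_lin_form.
apply: (@indep_g_sigma_algebra _ _ _ P (rects i)) => //.
- exact: setI_closed_rects.
- exact: measurable_rects.
- move=> F hF; rewrite setIC muleC.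
  apply: (@indep_g_sigma_algebra _ _ _ P (rects i')) => //.
  + exact: setI_closed_rects.
  + exact: measurable_rects.
  + exact: measurable_rects hF.
  + by move=> E hE; apply: indep_rects hE hF; rewrite eq_sym.
  + exact: lin_g_sigma_algebra.
- exact: lin_g_sigma_algebra.
Qed.

Lemma lin_right_count (a : 'rV[R]_p) : a != 0 -> 0 < qf Sig a -> (0 < n)%N ->
  (P [set t | \sum_(i < n) (\1_[set t | lin_mean a + Num.sqrt (qf Sig a) <= lin_form a i t] t : R)
       <= tail_mass * n%:R / 2]%R <= (4 / (tail_mass ^+ 2 * n%:R))%:E)%E.
Proof.
move=> a0 q0 n0; set s := Num.sqrt _.
have s0 : 0 < s by rewrite sqrtr_gt0.
have E i : [set t | lin_mean a + s <= lin_form a i t] = lin_form a i @^-1` [set x | lin_mean a + s <= x].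
  by [].
apply: count_lower_tail => //; last 2 first.
- exact: tail_mass_gt0.
- move=> i; rewrite E lin_normal //; last exact: measurable_ge.
  exact: normal_prob_right_tail.
- move=> i; rewrite E -[X in measurable X]setTI.
  by apply: measurable_lin_form => //; exact: measurable_ge.
- by move=> i j ij; rewrite !E lin_indep //; exact: measurable_ge.
Qed.

Lemma lin_left_count (a : 'rV[R]_p) : a != 0 -> 0 < qf Sig a -> (0 < n)%N ->
  (P [set t | \sum_(i < n) (\1_[set t | lin_form a i t <= lin_mean a - Num.sqrt (qf Sig a)] t : R)
       <= tail_mass * n%:R / 2]%R <= (4 / (tail_mass ^+ 2 * n%:R))%:E)%E.
Proof.
move=> a0 q0 n0; set s := Num.sqrt _.
have s0 : 0 < s by rewrite sqrtr_gt0.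
have E i : [set t | lin_form a i t <= lin_mean a - s] = lin_form a i @^-1` [set x | x <= lin_mean a - s].
  by [].
apply: count_lower_tail => //; last 2 first.
- exact: tail_mass_gt0.
- move=> i; rewrite E lin_normal //; last exact: measurable_le.
  exact: normal_prob_left_tail.
- move=> i; rewrite E -[X in measurable X]setTI.
  by apply: measurable_lin_form => //; exact: measurable_le.
- by move=> i j ij; rewrite !E lin_indep //; exact: measurable_le.
Qed.

(** Change of variables: the projection has a normal law, so the integral is one against
    [normal_prob]. *)
Lemma lin_variance_le a i : a != 0 -> 0 < qf Sig a ->
  (\int[P]_t ((lin_form a i t - lin_mean a) ^+ 2)%:E <= (6 * qf Sig a)%:E)%E.
Proof.
move=> a0 q0; set s := Num.sqrt (qf Sig a).
have s0 : 0 < s by rewrite sqrtr_gt0.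
have -> : qf Sig a = s ^+ 2 by rewrite sqr_sqrtr // ltW.
apply: le_trans (normal_prob_variance_le (lin_mean a) s s0).
have mlin1 := measurable_lin_form a i.
have mlinR : measurable_fun setT (lin_form a i : T -> measurableTypeR R) by [].
pose Y : {mfun T >-> measurableTypeR R} :=
  HB.pack (lin_form a i : T -> measurableTypeR R) (isMeasurableFun.Build _ _ _ _ _ mlinR).
have mf : measurable_fun setT (fun x : measurableTypeR R => ((x - lin_mean a) ^+ 2)%:E).
  by apply/measurable_EFinP/measurable_funX; exact: measurable_funB.
have f0 (x : measurableTypeR R) : (0 <= ((x - lin_mean a) ^+ 2)%:E)%E by rewrite lee_fin sqr_ge0.
have E1 : (\int[distribution P Y]_x ((x - lin_mean a) ^+ 2)%:E =
    \int[P]_t ((lin_form a i t - lin_mean a) ^+ 2)%:E)%E.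
  exact: (ge0_integral_distribution Y mf f0).
have E2 : (\int[normal_prob (lin_mean a) s]_x ((x - lin_mean a) ^+ 2)%:E =
    \int[distribution P Y]_x ((x - lin_mean a) ^+ 2)%:E)%E.
  apply: eq_measure_integral => A mA _.
  by symmetry; exact: lin_normal.
by rewrite E2 E1.
Qed.

End Sample.

(** * A net for quadratic forms *)

Section QuadraticForm.
Context {R : realType}.

Lemma qf_par p (A : 'M[R]_p) (a b : 'rV[R]_p) :
  qf A (a + b) + qf A (a - b) = 2 * qf A a + 2 * qf A b.
Proof.
have Dl (x y : 'rV[R]_p) (z : 'cV[R]_p) : ((x + y) *m A *m z) ord0 ord0 =
    (x *m A *m z) ord0 ord0 + (y *m A *m z) ord0 ord0 :> R.
  by rewrite !mulmxDl mxE.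
have Nl (y : 'rV[R]_p) (z : 'cV[R]_p) : ((- y) *m A *m z) ord0 ord0 =
    - (y *m A *m z) ord0 ord0 :> R.
  by rewrite !mulNmx mxE.
have Dr (x : 'rV[R]_p) (y z : 'cV[R]_p) : (x *m A *m (y + z)) ord0 ord0 =
    (x *m A *m y) ord0 ord0 + (x *m A *m z) ord0 ord0 :> R.
  by rewrite mulmxDr mxE.
have Nr (x : 'rV[R]_p) (y : 'cV[R]_p) : (x *m A *m (- y)) ord0 ord0 =
    - (x *m A *m y) ord0 ord0 :> R.
  by rewrite mulmxN mxE.
have tD : (a + b)^T = a^T + b^T by rewrite linearD.
have tB : (a - b)^T = a^T - b^T by rewrite linearB.
by rewrite /qf tD tB !(Dl, Dr, Nl, Nr); ring.
Qed.

Lemma qfZ p (A : 'M[R]_p) (c : R) (a : 'rV[R]_p) :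
  qf A (c *: a) = c ^+ 2 * qf A a.
Proof. by rewrite /qf linearZ /= -!scalemxAl -scalemxAr scalerA mxE expr2. Qed.

Lemma sqnZ p (c : R) (a : 'rV[R]_p) : sqn (c *: a) = c ^+ 2 * sqn a.
Proof. by rewrite /sqn mulr_sumr; apply: eq_bigr => i _; rewrite mxE exprMn. Qed.

(** The parallelogram identity gives [qf (x + y) <= 2 qf x + 2 qf y]; iteration yields the factor
    [2 ^+ d], a constant for fixed [d]. *)
Lemma qf_sum_le p (A : 'M[R]_p) (d : nat) (v : 'I_d -> 'rV[R]_p) :
  (forall a, 0 <= qf A a) ->
  qf A (\sum_k v k) <= 2 ^+ d * \sum_k qf A (v k).
Proof.
move=> psd; elim: d v => [|d IH] v.
  by rewrite !big_ord0 mulr0 /qf mul0mx mul0mx mxE.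
rewrite !big_ord_recr /=; set S := \sum_(_ < _) _; set Q := \sum_(_ < _) _.
have := qf_par _ A S (v ord_max).
have := psd (S - v ord_max); have := psd (v ord_max); have := IH (fun k => v (widen_ord (leqnSn d) k)).
rewrite -/S -/Q => h1 h2 h3 h4.
have h5 : 1 <= 2 ^+ d :> R by rewrite exprn_ege1 // ler1n.
apply: (@le_trans _ _ (2 * (2 ^+ d * Q) + 2 * qf A (v ord_max))); first by lra.
rewrite exprS -mulrA mulrDr [leRHS]mulrDr lerD2l ler_pM2l //.
by rewrite -[leLHS]mul1r ler_wpM2r.
Qed.

(** The points of the cube [-1, 1]^d with coordinates in multiples of [1 / N], indexed by a finite
    type so that a union bound can count them. *)
Definition grid (N d : nat) (K : {ffun 'I_d -> 'I_(N.*2.+1)}) : 'rV[R]_d :=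
  \row_k (((K k)%:R - N%:R) / N%:R).

(** Coordinates are rounded down. Coordinates equal to 1 or -1 are hit exactly, which keeps the
    approximation of a vector of sup norm 1 at Euclidean norm at least 1. *)
Lemma grid_approx (N d : nat) (u : 'rV[R]_d) : (0 < N)%N ->
  (forall k, `|u ord0 k| <= 1) -> exists K : {ffun 'I_d -> 'I_(N.*2.+1)},
  (forall k, `|grid N d K ord0 k - u ord0 k| <= N%:R^-1) /\
  (forall k, `|u ord0 k| = 1 -> grid N d K ord0 k = u ord0 k).
Proof.
move=> N0 u1; have N0' : 0 < N%:R :> R by rewrite ltr0n.
pose z k := Num.floor (N%:R * u ord0 k) + N%:Z.
have zb k : (`|z k| < N.*2.+1)%N /\ (0 <= z k).
  have := u1 k; rewrite ler_norml => /andP[h1 h2].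
  have z0 : 0 <= z k.
    rewrite /z -[leLHS](addNr N%:Z) lerD2r floor_ge_int rmorphN /=.
    by rewrite -mulrN1 ler_pM2l.
  split => //; rewrite -ltz_nat gez0_abs // -addnn -addn1 !PoszD ltzD1 /z lerD2r.
  rewrite -(ler_int R); apply: le_trans (floor_le _) _.
  by rewrite -[leRHS]mulr1 ler_pM2l.
exists [ffun k => Ordinal (zb k).1].
have gE k : grid N d [ffun k => Ordinal (zb k).1] ord0 k =
    (Num.floor (N%:R * u ord0 k))%:~R / N%:R.
  rewrite mxE ffunE /= natr_absz ger0_norm //; last by case: (zb k).
  by rewrite /z intrD addrK.
split => k; rewrite gE.
  have f1 := floor_le (N%:R * u ord0 k).
  have f2 := floorD1_gt (N%:R * u ord0 k).
  set f := Num.floor _ in f1 f2 *; rewrite intrD in f2.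
  have -> : f%:~R / N%:R - u ord0 k = (f%:~R - N%:R * u ord0 k) / N%:R.
    by field; rewrite gt_eqF.
  rewrite normrM [`|_^-1|]ger0_norm ?invr_ge0 ?(ltW N0') //.
  rewrite -[leRHS]mul1r ler_wpM2r ?invr_ge0 ?(ltW N0') //.
  by rewrite ler_norml; apply/andP; split; lra.
move=> uk; have [->|->] : u ord0 k = 1 \/ u ord0 k = -1.
  have [h|h] := leP 0 (u ord0 k).
    by left; rewrite -uk ger0_norm.
  by right; rewrite -uk ltr0_norm // opprK.
- have -> : Num.floor (N%:R * 1 : R) = N%:Z by rewrite mulr1 -[N%:R]/(N%:Z%:~R) intrKfloor.
  by rewrite divff ?gt_eqF.
- have -> : Num.floor (N%:R * -1 : R) = - N%:Z.
    by rewrite mulrN1 -[N%:R]/(N%:Z%:~R) -rmorphN intrKfloor.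
  by rewrite rmorphN /= mulNr divff ?gt_eqF.
Qed.

(** After scaling [u] to sup norm 1, let [v] be its grid approximation. The parallelogram identity
    gives [qf v <= 2 qf u + 2 qf (v - u)], where [qf v >= c] and the energy bound [C] makes
    [qf (v - u) <= c / 4]. Hence [qf u >= c / 4], while [sqn u <= d]. *)
Lemma qf_net p (A : 'M[R]_p) (d N : nat) (F : 'M[R]_(d, p)) (c C : R) :
  (forall a, 0 <= qf A a) -> (0 < N)%N -> 0 <= c ->
  (forall K, grid N d K != 0 -> c * sqn (grid N d K) <= qf A (grid N d K *m F)) ->
  \sum_k qf A (row k F) <= C -> 2 ^+ d * C / N%:R ^+ 2 <= c / 4 ->
  forall u : 'rV[R]_d, c / (4 * d%:R) * sqn u <= qf A (u *m F).
Proof.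
move=> psd N0 c0 hK hC hN u.
have [->|un0] := eqVneq u 0.
  by rewrite mul0mx /qf mul0mx mul0mx mxE sqnE mul0mx mxE mulr0.
have [k0 k0P] : exists k0, forall k, `|u ord0 k| <= `|u ord0 k0|.
  case: d F hK hC hN u un0 => [|d] F hK hC hN u un0.
    by move/eqP: un0; case; apply/rowP => -[].
  have [k _ hk] := @arg_maxP _ _ _ (ord0 : 'I_d.+1) xpredT (fun k => `|u ord0 k|) isT.
  by exists k => j; exact: hk.
have m0 : 0 < `|u ord0 k0|.
  rewrite lt_def normr_ge0 andbT; apply: contra un0 => /eqP h.
  apply/eqP/rowP => k; rewrite mxE; apply/eqP; rewrite -normr_eq0.
  by rewrite eq_le normr_ge0 andbT -h k0P.
set m := `|u ord0 k0| in k0P m0.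
pose u1 := m^-1 *: u.
have uE : u = m *: u1 by rewrite scalerA divff ?gt_eqF // scale1r.
suff : c / (4 * d%:R) * sqn u1 <= qf A (u1 *m F).
  move=> h; rewrite uE sqnZ -scalemxAl qfZ mulrCA ler_wpM2l // sqr_ge0 //.
have u1le k : `|u1 ord0 k| <= 1.
  by rewrite mxE normrM [`|m^-1|]ger0_norm ?invr_ge0 ?(ltW m0) // ler_pdivrMl ?mulr1.
have u1k0 : `|u1 ord0 k0| = 1.
  by rewrite mxE normrM [`|m^-1|]ger0_norm ?invr_ge0 ?(ltW m0) // -/m mulVf ?gt_eqF.
have [K [K1 K2]] := grid_approx N d u1 N0 u1le.
set v := grid N d K in K1 K2.
have v1 : 1 <= sqn v.
  rewrite /sqn (bigD1 k0) //= K2 // -real_normK ?num_real // u1k0 expr1n lerDl.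
  by apply: sumr_ge0 => k _; exact: sqr_ge0.
have v0 : v != 0.
  by apply/eqP => v0; move: v1; rewrite v0 sqnE mul0mx mxE ler10.
have h1 : c <= qf A (v *m F).
  by apply: le_trans (hK K v0); rewrite -[leLHS]mulr1 ler_wpM2l.
have h2 : qf A ((v - u1) *m F) <= c / 4.
  apply: le_trans hN.
  have -> : (v - u1) *m F = \sum_k ((v - u1) ord0 k *: row k F).
    by rewrite mulmx_sum_row.
  apply: le_trans (qf_sum_le _ A _ _ psd) _.
  rewrite -mulrA ler_pM2l ?exprn_gt0 //.
  apply: (@le_trans _ _ (\sum_k N%:R ^- 2 * qf A (row k F))).
    apply: ler_sum => k _; rewrite qfZ ler_wpM2r //.
    rewrite -real_normK ?num_real // -exprVn ler_sqr ?nnegrE ?invr_ge0 //.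
    by have := K1 k; rewrite !mxE.
  by rewrite -mulr_sumr mulrC ler_wpM2r // invr_ge0 sqr_ge0.
have h3 := qf_par _ A (u1 *m F) ((v - u1) *m F).
have h4 := psd (u1 *m F - (v - u1) *m F).
rewrite -mulmxDl (addrC u1) subrK in h3.
have h5 : c / 4 <= qf A (u1 *m F) by lra.
apply: le_trans h5.
have d0 : 0 < d%:R :> R by rewrite ltr0n (leq_ltn_trans _ (ltn_ord k0)).
have sd : sqn u1 <= d%:R.
  rewrite /sqn -[d in d%:R]card_ord -sumr_const; apply: ler_sum => k _.
  by rewrite -real_normK ?num_real // -[leRHS](expr1n _ 2) ler_sqr ?nnegrE.
rewrite invfM mulrA -[leRHS]mulr1 -mulrA ler_wpM2l ?divr_ge0 //.
by rewrite mulrC ler_pdivrMr ?mul1r.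
Qed.

End QuadraticForm.

(** * Deterministic bounds on the sample covariance *)

Lemma sum_drop (R : realType) (s : seq R) (k l : nat) : (k <= size s)%N ->
  \sum_(c <- drop k s) c ^+ l = \sum_(i < size s | (k <= i)%N) s`_i ^+ l.
Proof.
move=> ks; rewrite (big_nth 0) size_drop.
rewrite -(big_mkord (fun i => (k <= i)%N) (fun i => s`_i ^+ l)).
have -> : \sum_(0 <= i < size s | (k <= i)%N) s`_i ^+ l =
    \sum_(k <= i < size s) s`_i ^+ l.
  rewrite (@big_cat_nat _ _ _ k) //= big1_seq ?add0r; last first.
    by move=> i /andP[ki]; rewrite mem_index_iota => /andP[_]; rewrite ltnNge ki.
  rewrite big_nat_cond [RHS]big_nat_cond; apply: eq_bigl => i.
  by case: (k <= i)%N; rewrite /= ?andbT ?andbF.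
rewrite -[in RHS](add0n k) big_addn.
by apply: eq_big => [i|i _]; rewrite ?nth_drop ?leq_addl // addnC.
Qed.

Section SampleCov.
Context {R : realType} {n p : nat}.
Implicit Types (x : 'I_n -> 'I_p -> R) (a : 'rV[R]_p).

(** The right-hand side is the sample variance of the projections on [a], so bounds on the form
    become statements about real samples. *)
Lemma qf_sample_cov x a : qf (sample_cov x) a = (n%:R - 1)^-1 *
  \sum_(i < n) (\sum_(j < p) a ord0 j * x i j -
     n%:R^-1 * \sum_(k < n) \sum_(j < p) a ord0 j * x k j) ^+ 2.
Proof.
pose y i j := x i j - sample_mean x j.
have yE i : \sum_(j < p) a ord0 j * x i j -
     n%:R^-1 * \sum_(k < n) \sum_(j < p) a ord0 j * x k j =
     \sum_(j < p) a ord0 j * y i j.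
  rewrite exchange_big /= mulr_sumr -sumrB; apply: eq_bigr => j _.
  by rewrite /y /sample_mean -mulr_sumr; ring.
under eq_bigr => i _ do rewrite yE.
rewrite qfE.
transitivity (\sum_(j < p) \sum_(l < p) \sum_(i < n)
    (n%:R - 1)^-1 * ((a ord0 j * y i j) * (a ord0 l * y i l))).
  apply: eq_bigr => j _; apply: eq_bigr => l _.
  rewrite mxE mulr_sumr mulr_sumr mulr_suml; apply: eq_bigr => i _.
  by rewrite /y; ring.
under [LHS]eq_bigr => j _ do rewrite exchange_big /=.
rewrite exchange_big /= mulr_sumr; apply: eq_bigr => i _.
rewrite expr2 big_distrlr /= mulr_sumr; apply: eq_bigr => j _.
by rewrite mulr_sumr.
Qed.

Lemma qf_sample_cov_ge0 x a : (1 < n)%N -> 0 <= qf (sample_cov x) a.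
Proof.
move=> n1; rewrite qf_sample_cov mulr_ge0 //.
  by rewrite invr_ge0 subr_ge0 ler1n ltnW.
by apply: sumr_ge0 => i _; exact: sqr_ge0.
Qed.

(** The empirical mean minimizes the sum of squared deviations, so it may be replaced by any centre,
    in particular the true mean. *)
Lemma qf_sample_cov_le x a (c : R) : (1 < n)%N -> qf (sample_cov x) a <=
  (n%:R - 1)^-1 * \sum_(i < n) (\sum_(j < p) a ord0 j * x i j - c) ^+ 2.
Proof.
move=> n1; rewrite qf_sample_cov ler_wpM2l //.
  by rewrite invr_ge0 subr_ge0 ler1n ltnW.
set y := fun i => \sum_(j < p) a ord0 j * x i j; set z := n%:R^-1 * _.
have n0 : n%:R != 0 :> R by rewrite pnatr_eq0 -lt0n ltnW.
have sy : \sum_(i < n) y i = n%:R * z by rewrite /z mulrA divff ?mul1r.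
have sqE w : \sum_(i < n) (y i - w) ^+ 2 =
    \sum_(i < n) y i ^+ 2 - 2 * w * (n%:R * z) + n%:R * w ^+ 2.
  rewrite (eq_bigr (fun i => y i ^+ 2 + (- (2 * w) * y i + w ^+ 2))); last first.
    by move=> i _; ring.
  rewrite !big_split /= -mulr_sumr sy sumr_const card_ord -mulr_natl; ring.
rewrite -/y !sqE -subr_ge0.
set V := \sum_(_ < _) _.
have -> : V - 2 * c * (n%:R * z) + n%:R * c ^+ 2 -
   (V - 2 * z * (n%:R * z) + n%:R * z ^+ 2) = n%:R * (z - c) ^+ 2 by ring.
by rewrite mulr_ge0 // sqr_ge0.
Qed.

(** If the empirical mean is at most [c], the points above [c + s] are at distance at least [s] from
    it; otherwise the points below [c - s] are. *)
Lemma qf_sample_cov_ge x a (c s w : R) : (1 < n)%N -> 0 <= s ->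
  w <= \sum_(i < n) (c + s <= \sum_(j < p) a ord0 j * x i j)%R%:R ->
  w <= \sum_(i < n) (\sum_(j < p) a ord0 j * x i j <= c - s)%R%:R ->
  (n%:R - 1)^-1 * (w * s ^+ 2) <= qf (sample_cov x) a.
Proof.
move=> n1 s0 hr hl; rewrite qf_sample_cov ler_wpM2l //.
  by rewrite invr_ge0 subr_ge0 ler1n ltnW.
set z := n%:R^-1 * _.
have [zc|cz] := leP z c.
  apply: le_trans (ler_wpM2r (sqr_ge0 s) hr) _.
  rewrite mulr_suml; apply: ler_sum => i _.
  case: (leP (c + s)) => [h|_]; last by rewrite /= mul0r sqr_ge0.
  by rewrite /= mul1r ler_sqr ?nnegrE; lra.
apply: le_trans (ler_wpM2r (sqr_ge0 s) hl) _.
rewrite mulr_suml; apply: ler_sum => i _.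
case: (leP _ (c - s)) => [h|_]; last by rewrite /= mul0r sqr_ge0.
by rewrite /= mul1r -[leRHS]sqrrN ler_sqr ?nnegrE; lra.
Qed.

Lemma momE x (k l : nat) : (k <= p)%N -> mom l (p - k) (sample_cov x) =
  (p%:R - k%:R)^-1 * \sum_(i < p | (k <= i)%N) (eigs (sample_cov x))`_i ^+ l.
Proof.
move=> kp; rewrite /mom natrB // subKn //; congr (_ * _).
by rewrite sum_drop ?size_eigs ?sample_cov_sym.
Qed.

(** Here [d] is the index of the last spike, counted from 0. With [l] the eigenvalue of index [k],
    the sum of squares is at least [l^2] and the sum at most [d.+1 l + B]; the ratio
    [l / (d.+1 l + B)] increases in [l], so [L] may replace [l]. *)
Lemma T_stat_ge x (k d : nat) (L B : R) : (1 < n)%N -> (k <= d < p)%N -> 0 < L ->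
  L <= (eigs (sample_cov x))`_d ->
  \sum_(i < p | (d < i)%N) (eigs (sample_cov x))`_i <= B ->
  (p%:R - k%:R) * (L / (d.+1%:R * L + B)) ^+ 2 - 1 <= T_stat k x.
Proof.
move=> n1 /andP[kd dp] L0 hL hB.
set s := eigs (sample_cov x) in hL hB *.
have s0 i : 0 <= s`_i.
  by apply: eigs_ge0; [exact: sample_cov_sym|move=> a; exact: qf_sample_cov_ge0].
have kp : (k < p)%N := leq_ltn_trans kd dp.
have B0 : 0 <= B by apply: le_trans hB; apply: sumr_ge0.
have r0 : 0 < p%:R - k%:R :> R by rewrite subr_gt0 ltr_nat.
pose l := s`_k.
have Ll : L <= l by apply: le_trans hL _; rewrite eigs_nonincr ?sample_cov_sym ?kd.
pose S1 := \sum_(i < p | (k <= i)%N) s`_i; pose S2 := \sum_(i < p | (k <= i)%N) s`_i ^+ 2.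
have lS1 : l <= S1.
  rewrite /S1 (bigD1 (Ordinal kp)) //= lerDl; exact: sumr_ge0.
have lS2 : l ^+ 2 <= S2.
  by rewrite /S2 (bigD1 (Ordinal kp)) //= lerDl sumr_ge0 // => i _; exact: sqr_ge0.
have S1l : S1 <= d.+1%:R * l + B.
  rewrite /S1 (bigID (fun i : 'I_p => (d < i)%N)) /= addrC lerD //.
    apply: (@le_trans _ _ (\sum_(i < p | (i <= d)%N) l)).
      rewrite big_mkcond [leRHS]big_mkcond; apply: ler_sum => i _.
      rewrite -leqNgt; case: ifP => [/andP[ki ->]|_].
        by rewrite eigs_nonincr ?sample_cov_sym // ki ltn_ord.
      by case: ifP => // _; exact: s0.
    rewrite -(big_ord_widen _ (fun=> l) dp) sumr_const card_ord mulr_natl //.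
  apply: le_trans hB; rewrite big_mkcond [leRHS]big_mkcond; apply: ler_sum => i _.
  case: ifP => [/andP[_ ->] //|_]; by case: ifP.
have l0 : 0 < l by exact: lt_le_trans L0 Ll.
have S10 : 0 < S1 by exact: lt_le_trans l0 lS1.
rewrite /T_stat lerD2r !momE ?(ltnW kp) // -/s.
under [X in _ / (_ * X) ^+ 2]eq_bigr => i _ do rewrite expr1.
rewrite -/S1 -/S2.
have -> : (p%:R - k%:R)^-1 * S2 / ((p%:R - k%:R)^-1 * S1) ^+ 2 =
   (p%:R - k%:R) * (S2 / S1 ^+ 2) by field; rewrite !gt_eqF.
rewrite ler_pM2l //.
apply: (@le_trans _ _ ((l / S1) ^+ 2)); last first.
  by rewrite exprMn exprVn ler_wpM2r // invr_ge0 sqr_ge0.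
have dL : 0 < d.+1%:R * L + B by rewrite ltr_wpDr // mulr_gt0.
rewrite ler_sqr ?nnegrE ?divr_ge0 ?(ltW L0) ?(ltW l0) ?(ltW S10) ?(ltW dL) //.
rewrite ler_pdivrMr // mulrAC ler_pdivlMr //.
apply: (@le_trans _ _ (L * (d.+1%:R * l + B))); first by rewrite ler_pM2l.
by rewrite !mulrDr lerD // ?ler_wpM2r // mulrCA [leRHS]mulrCA mulrC [leRHS]mulrC (mulrC l L).
Qed.

(** The factor [rho = 1 + 2 M + 2 p / n] satisfies [(n / 2) (rho - 1) = M n + p], so [T > rho - 1]
    suffices once [n - k - 1 >= n / 2]. The last two hypotheses control the two terms of
    [(D L + K p)^2 <= 2 (D L)^2 + 2 (K p)^2]. *)
Lemma g_stat_gt x (k d : nat) (L K M : R) : (1 < n)%N -> (k <= d < p)%N ->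
  0 < L -> 0 < K -> 0 < M ->
  L <= (eigs (sample_cov x))`_d ->
  \sum_(i < p | (d < i)%N) (eigs (sample_cov x))`_i <= K * p%:R ->
  2 * k.+1%:R <= n%:R :> R -> 2 * k%:R <= p%:R :> R ->
  16 * d.+1%:R ^+ 2 * (1 + 2 * M + 2 * (p%:R / n%:R)) < p%:R ->
  16 * K ^+ 2 * p%:R * (1 + 2 * M + 2 * (p%:R / n%:R)) < L ^+ 2 ->
  M < g_stat k x / n%:R.
Proof.
move=> n1 kdp L0 K0 M0 hL hB hn hp h1 h2.
have := T_stat_ge x k d L (K * p%:R) n1 kdp L0 hL hB.
rewrite /g_stat; set Tk := T_stat k x; set rho := 1 + 2 * M + _ in h1 h2.
have n0 : 0 < n%:R :> R by rewrite ltr0n ltnW.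
have p0 : 0 < p%:R :> R by rewrite ltr0n; case/andP: kdp => _; exact: leq_ltn_trans.
set D := d.+1%:R in h1 *.
have D0 : 0 < D by rewrite /D ltr0n.
have KP0 : 0 < K * p%:R by rewrite mulr_gt0.
have den0 : 0 < D * L + K * p%:R by rewrite addr_gt0 ?mulr_gt0.
have rho0 : 0 < rho by rewrite /rho; have := divr_gt0 p0 n0; lra.
have hr : rho < (p%:R - k%:R) * (L / (D * L + K * p%:R)) ^+ 2.
  rewrite expr_div_n mulrA ltr_pdivlMr ?exprn_gt0 //.
  have e1 : (D * L + K * p%:R) ^+ 2 <= 2 * (D * L) ^+ 2 + 2 * (K * p%:R) ^+ 2.
    by have := sqr_ge0 (D * L - K * p%:R); rewrite sqrrB sqrrD; lra.
  have L20 : 0 < L ^+ 2 by rewrite exprn_gt0.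
  have e2 : 16 * D ^+ 2 * rho * L ^+ 2 < p%:R * L ^+ 2 by rewrite ltr_pM2r.
  have e3 : 16 * K ^+ 2 * p%:R * rho * p%:R < L ^+ 2 * p%:R by rewrite ltr_pM2r.
  have e4 : rho * (D * L + K * p%:R) ^+ 2 <= rho * (2 * (D * L) ^+ 2 + 2 * (K * p%:R) ^+ 2).
    by rewrite ler_pM2l.
  have e5 : p%:R / 2 * L ^+ 2 <= (p%:R - k%:R) * L ^+ 2.
    rewrite ler_pM2r //; lra.
  have e6 : rho * (2 * (D * L) ^+ 2 + 2 * (K * p%:R) ^+ 2) =
    (16 * D ^+ 2 * rho * L ^+ 2 + 16 * K ^+ 2 * p%:R * rho * p%:R) / 8 by field.
  have e7 : 0 < p%:R * L ^+ 2 by rewrite mulr_gt0.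
  rewrite e6 in e4; lra.
move=> hT; have {hr}hT : rho - 1 < Tk by apply: lt_le_trans hT; rewrite ltrD2r.
have k1 : k.+1%:R = k%:R + 1 :> R by rewrite -natr1.
have k0 : 0 <= k%:R :> R by [].
rewrite ltr_pdivlMr //.
rewrite k1 in hn; have nk : n%:R / 2 <= n%:R - k%:R - 1 :> R by lra.
have e1 : n%:R / 2 * (rho - 1) <= (n%:R - k%:R - 1) * (rho - 1).
  by rewrite ler_wpM2r //; rewrite /rho; have := divr_gt0 p0 n0; lra.
have e2 : (n%:R - k%:R - 1) * (rho - 1) < (n%:R - k%:R - 1) * Tk.
  by rewrite ltr_pM2l //; lra.
have e3 : n%:R / 2 * (rho - 1) = M * n%:R + p%:R.
  by rewrite /rho; field; rewrite gt_eqF.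
lra.
Qed.

End SampleCov.

(** * Probability bound for one sample size *)

Lemma probability_bigsetU_le (R : realType) (dT : measure_display)
    (T : measurableType dT) (P : probability T R) (I : Type) (r : seq I)
    (A : I -> set T) (c : R) :
  (forall i, measurable (A i)) -> (forall i, P (A i) <= c%:E)%E ->
  (P (\big[setU/set0]_(i <- r) A i) <= ((size r)%:R * c)%:E)%E.
Proof.
move=> mA hA; elim: r => [|i r IH]; first by rewrite big_nil measure0 mul0r.
rewrite big_cons /= -natr1 mulrDl mul1r EFinD addeC.
apply: le_trans (measureU2 _ _ _) _ => //; first exact: bigsetU_measurable.
by apply: leeD; [exact: hA|exact: IH].
Qed.

Section OneSample.
Context {R : realType} {dT : measure_display} {T : measurableType dT}.
Context {P : probability T R} {n p : nat} (mu : 'cV[R]_p) (Sig : 'M[R]_p).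
Context (X : 'I_n -> 'I_p -> {RV P >-> R}).
Hypothesis HX : gaussian_sample mu Sig X.
Hypothesis n1 : (1 < n)%N.

Let S t := sample_cov (fun i j => X i j t).

Lemma measurable_qf_sample_cov a : measurable_fun setT (fun t => qf (S t) a).
Proof.
under eq_fun => t do rewrite qf_sample_cov.
apply: measurable_funM => //; apply: measurable_sum => i.
apply: measurable_funX; apply: measurable_funB; first exact: measurable_lin_form.
by apply: measurable_funM => //; apply: measurable_sum => j; exact: measurable_lin_form.
Qed.

(** Centring at the true mean leaves [n / (n - 1) <= 2] times the crude variance bound
    [6 * qf Sig a]. *)
Lemma integral_qf_le a : a != 0 -> 0 < qf Sig a ->
  (\int[P]_t (qf (S t) a)%:E <= (12 * qf Sig a)%:E)%E.
Proof.
move=> a0 q0; pose m := lin_mean mu a.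
have n10 : 0 < n%:R - 1 :> R by rewrite subr_gt0 ltr1n.
have mh i : measurable_fun setT (fun t => ((lin_form X a i t - m) ^+ 2)%:E).
  by apply/measurable_EFinP/measurable_funX/measurable_funB => //; exact: measurable_lin_form.
have h0 i t : (0 <= ((lin_form X a i t - m) ^+ 2)%:E)%E by rewrite lee_fin sqr_ge0.
apply: (@le_trans _ _ (\int[P]_t ((n%:R - 1)^-1%:E *
    \sum_(i <- enum 'I_n) ((lin_form X a i t - m) ^+ 2)%:E)%E)%E).
  apply: ge0_le_integral => //=.
  - by move=> t _; rewrite lee_fin qf_sample_cov_ge0.
  - by apply/measurable_EFinP; exact: measurable_qf_sample_cov.
  - by apply: emeasurable_funM => //; exact: emeasurable_sum.
  - move=> t _; rewrite sumEFin -EFinM lee_fin big_enum /=.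
    exact: qf_sample_cov_le.
rewrite ge0_integralZl //; last 3 first.
- exact: emeasurable_sum.
- by move=> t _; exact: sume_ge0.
- by rewrite lee_fin invr_ge0 ltW.
rewrite ge0_integral_sum //.
apply: (@le_trans _ _ ((n%:R - 1)^-1%:E * \sum_(i <- enum 'I_n) (6 * qf Sig a)%:E)%E).
  apply: lee_wpmul2l; first by rewrite lee_fin invr_ge0 ltW.
  by apply: lee_sum => i _; exact: lin_variance_le.
rewrite sumEFin big_enum sumr_const card_ord -EFinM lee_fin ler_pdivrMl //.
have n2 : 2 <= n%:R :> R by rewrite ler_nat.
rewrite -[leLHS]mulr_natl; set Q := qf Sig a in q0 *.
have -> : (n%:R - 1) * (12 * Q) = (12 * n%:R - 12) * Q by ring.
have -> : n%:R * (6 * Q) = 6 * n%:R * Q by ring.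
by rewrite ler_pM2r //; lra.
Qed.

(** Used for the noise directions and for the whitened spike directions. Indices outside [Q]
    contribute 0, and the bound counts all [m] indices. *)
Lemma markov_qf (m : nat) (Q : pred 'I_m) (w : 'I_m -> 'rV[R]_p) (b K : R) :
  0 < b -> (forall i, Q i -> w i != 0 /\ 0 < qf Sig (w i) <= b) -> 0 < K ->
  (P [set t | K <= \sum_(i < m | Q i) qf (S t) (w i)]%R <= (12 * m%:R * b / K)%:E)%E.
Proof.
move=> b0 hw K0; pose h i t : R := if Q i then qf (S t) (w i) else 0.
have h0 i t : 0 <= h i t by rewrite /h; case: ifP => // _; exact: qf_sample_cov_ge0.
have mh i : measurable_fun setT (h i).
  by rewrite /h; case: (Q i) => //; exact: measurable_qf_sample_cov.
have hE t : \sum_(i < m | Q i) qf (S t) (w i) = \sum_(i < m) h i t.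
  by rewrite big_mkcond.
under eq_set => t do rewrite hE.
apply: markov_ge0 => //.
- exact: measurable_sum.
- by move=> t; exact: sumr_ge0.
under eq_integral => t _ do rewrite -sumEFin.
rewrite ge0_integral_sum //; last 2 first.
- by move=> i; exact/measurable_EFinP.
- by move=> i t _; rewrite lee_fin.
apply: (@le_trans _ _ (\sum_(i < m) (12 * b)%:E)%E).
  apply: lee_sum => i _; have [Qi|nQi] := boolP (Q i); last first.
    under eq_integral => t _ do rewrite /h (negbTE nQi).
    by rewrite integral0 lee_fin mulr_ge0 // ltW.
  have [w0 /andP[q0 qb]] := hw i Qi.
  under eq_integral => t _ do rewrite /h Qi.
  apply: le_trans (integral_qf_le (w i) w0 q0) _.
  by rewrite lee_fin ler_pM2l.
by rewrite sumEFin sumr_const card_ord lee_fin -[leLHS]mulr_natr mulrAC.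
Qed.

(* [C] bounds the energy of the noise directions and of the whitened spike
   directions outside events controlled by Markov's inequality; the last term
   is the union bound over the net of mesh [1 / N]. *)
Lemma g_stat_prob_le (k d N : nat) (sigma2 C M : R) (lam : nat -> R) :
  Sig^T = Sig -> (k <= d < p)%N -> 0 < sigma2 ->
  char_poly Sig = (\prod_(k < d.+1) ('X - (lam k)%:P)) * ('X - sigma2%:P) ^+ (p - d.+1) ->
  (forall k, (k <= d)%N -> lam d <= lam k) -> sigma2 < lam d ->
  0 < C -> 0 < M -> (0 < N)%N ->
  2 ^+ d.+1 * C / N%:R ^+ 2 <= tail_mass / 8 ->
  2 * k.+1%:R <= n%:R :> R -> 2 * k%:R <= p%:R :> R ->
  16 * d.+1%:R ^+ 2 * (1 + 2 * M + 2 * (p%:R / n%:R)) < p%:R ->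
  16 * C ^+ 2 * p%:R * (1 + 2 * M + 2 * (p%:R / n%:R)) <
    (tail_mass / (8 * d.+1%:R) * lam d) ^+ 2 ->
  (P [set t | g_stat k (fun i j => X i j t) / n%:R <= M]%R <=
   (12 * sigma2 / C + 12 * d.+1%:R / C +
    #|{: bool * {ffun 'I_d.+1 -> 'I_(N.*2.+1)}}|%:R * (4 / (tail_mass ^+ 2 * n%:R)))%:E)%E.
Proof.
move=> symSig /andP[kd dp] s20 chS lamd lams C0 M0 N0 hN hn hp h1 h2.
have q0 := @tail_mass_gt0 R.
have n0 : (0 < n)%N by exact: ltnW.
have lam0 : 0 < lam d by exact: lt_trans lams.
have lamk0 (i : 'I_d.+1) : 0 < lam i by apply: lt_le_trans (lamd _ _) => //; rewrite -ltnS.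
(* Spikes first, noise after: the rows of [V] of index above [d] are then noise eigenvectors. *)
pose s := mkseq lam d.+1 ++ nseq (p - d.+1) sigma2.
have [V [VV SigE]] : exists V : 'M[R]_p, V *m V^T = 1%:M /\
    Sig = V^T *m diag_mx (\row_i s`_i) *m V.
  apply: sym_orthodiag => //; rewrite chS /s big_cat /= big_map; congr (_ * _).
    by rewrite -(big_mkord xpredT (fun i => 'X - (lam i)%:P)) /index_iota subn0.
  by rewrite big_nseq; elim: (p - d.+1)%N => //= m IH; rewrite exprS IH.
have s_lo i : (i <= d)%N -> s`_i = lam i.
  by move=> id; rewrite /s nth_cat size_mkseq ltnS id nth_mkseq.
have s_hi (i : 'I_p) : (d < i)%N -> s`_i = sigma2.
  move=> di; rewrite /s nth_cat size_mkseq ltnS leqNgt di /= nth_nseq.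
  by rewrite ltn_sub2r // (leq_ltn_trans _ (ltn_ord i)).
have VSV : V *m Sig *m V^T = diag_mx (\row_i s`_i).
  rewrite SigE !mulmxA VV mul1mx -mulmxA VV mulmx1 //.
have Vn0 i : row i V != 0.
  apply/eqP => rV; have /matrixP/(_ i i) := VV; rewrite !mxE eqxx.
  move/rowP: rV => rV; rewrite big1 => [/eqP|j _]; first by rewrite eq_sym oner_eq0.
  by have := rV j; rewrite !mxE => ->; rewrite mul0r.
have qfV i : qf Sig (row i V) = s`_i.
  have := congr1 (fun A : 'M[R]_p => A i i) VSV; rewrite !mxE eqxx mulr1n => <-.
  rewrite /qf !mxE; apply: eq_bigr => j _; congr (_ * _); last by rewrite !mxE.
  by rewrite !mxE; apply: eq_bigr => l _; rewrite !mxE.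
pose f : 'I_d.+1 -> 'I_p := widen_ord dp.
have finj : injective f by move=> x y /(congr1 val) /= xy; exact: val_inj.
pose U := rowsub f V.
have UU : U *m U^T = 1%:M by exact: rowsub_orthonormal.
pose e : 'rV[R]_d.+1 := \row_i Num.sqrt (lam i).
pose ei : 'rV[R]_d.+1 := \row_i (Num.sqrt (lam i))^-1.
have ee : diag_mx e *m diag_mx ei = 1%:M.
  apply/matrixP => i j; rewrite mul_diag_mx !mxE.
  have [->|ij] := eqVneq i j; last by rewrite mulr0n mulr0.
  by rewrite !mulr1n divff // gt_eqF // sqrtr_gt0.
(* Whitened spike directions: [F Sig F^T = 1], so the projection on [v *m F] has variance
   [sqn v]. *)
pose F := diag_mx ei *m U.
have FF (v : 'rV[R]_d.+1) : qf Sig (v *m F) = sqn v.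
  have FSF : F *m Sig *m F^T = 1%:M.
    have USU : U *m Sig *m U^T = diag_mx (\row_i lam i).
      apply/matrixP => i j; have /matrixP/(_ (f i) (f j)) := VSV.
      rewrite [RHS]mxE (inj_eq finj) [(\row_i _) _ _]mxE s_lo; last by rewrite -ltnS /=.
      move=> E; rewrite [RHS]mxE [(\row_i _) _ _]mxE -E !mxE.
      apply: eq_bigr => l _; rewrite !mxE; congr (_ * _).
      by apply: eq_bigr => l' _; rewrite !mxE.
    have -> : F *m Sig *m F^T = diag_mx ei *m (U *m Sig *m U^T) *m diag_mx ei.
      by rewrite /F trmx_mul tr_diag_mx !mulmxA.
    rewrite USU.
    apply/matrixP => i j; rewrite mul_mx_diag mul_diag_mx !mxE.
    have [->|ij] := eqVneq i j; last by rewrite mulr0n mulr0 mul0r.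
    rewrite !mulr1n -{2}(sqr_sqrtr (ltW (lamk0 j))) expr2.
    by rewrite mulKf ?divff // gt_eqF // sqrtr_gt0.
  have -> : qf Sig (v *m F) = (v *m (F *m Sig *m F^T) *m v^T) ord0 ord0.
    by rewrite /qf trmx_mul !mulmxA.
  by rewrite FSF mulmx1 -sqnE.
(* Three bad events: large noise energy, large energy of the whitened spike directions, and some
   grid direction with too few observations in one of its two tails. *)
pose G := grid (R := R) N d.+1.
pose Bad1 := [set t | C * p%:R <= \sum_(i < p | (d < i)%N) qf (S t) (row i V)]%R.
pose Bad2 := [set t | C <= \sum_(i < d.+1) qf (S t) (row i F)]%R.
pose A (bK : bool * {ffun 'I_d.+1 -> 'I_(N.*2.+1)}) : set T :=
  let a := G bK.2 *m F in
  (* The zero grid point has no normal law attached and gets the empty event; the boolean selects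
     the tail. *)
  if G bK.2 == 0 then set0 else
  if bK.1 then [set t | \sum_(i < n) (\1_[set t | lin_mean mu a + Num.sqrt (qf Sig a)
       <= lin_form X a i t] t : R) <= tail_mass * n%:R / 2]%R
  else [set t | \sum_(i < n) (\1_[set t | lin_form X a i t <= lin_mean mu a -
       Num.sqrt (qf Sig a)] t : R) <= tail_mass * n%:R / 2]%R.
pose Bad3 := \big[setU/set0]_(bK <- enum {: bool * {ffun 'I_d.+1 -> 'I_(N.*2.+1)}}) A bK.
have p0 : 0 < p%:R :> R by rewrite ltr0n (leq_ltn_trans _ dp).
have PBad1 : (P Bad1 <= (12 * sigma2 / C)%:E)%E.
  apply: le_trans (markov_qf p _ (fun i => row i V) sigma2 _ s20 _ _) _.
  - by move=> i di; split => //; rewrite qfV s_hi // s20 lexx.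
  - by rewrite mulr_gt0.
  rewrite lee_fin (_ : _ / _ = 12 * sigma2 / C) //.
  by field; rewrite !gt_eqF.
have rowF i : row i F = delta_mx ord0 i *m F by rewrite rowE.
have delta0 (i : 'I_d.+1) : delta_mx ord0 i != 0 :> 'rV[R]_d.+1.
  by apply/eqP => /rowP/(_ i); rewrite !mxE !eqxx => /eqP; rewrite oner_eq0.
have nzF (v : 'rV[R]_d.+1) : v != 0 -> v *m F != 0.
  move=> v0; apply/eqP => vF; have := FF v; rewrite vF /qf !mul0mx mxE => E.
  by have := sqn_gt0 _ v v0; rewrite -E ltxx.
have PBad2 : (P Bad2 <= (12 * d.+1%:R / C)%:E)%E.
  apply: le_trans (markov_qf d.+1 _ (fun i => row i F) 1 _ ltr01 _ _) _ => //.
  - move=> i _; rewrite rowF; split; first exact: nzF.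
    rewrite FF sqn_gt0 //= /sqn (bigD1 i) //= big1 ?addr0 ?mxE ?eqxx ?expr1n //.
    by move=> j ji; rewrite mxE eqxx (negbTE ji) expr0n.
  by rewrite mulr1.
have mA bK : measurable (A bK).
  rewrite /A; case: ifP => // _; case: ifP => _; apply: measurable_le_cst => //;
    apply: measurable_sum => i; apply: measurable_indic;
    [apply: measurable_ge_cst|apply: measurable_le_cst]; exact: measurable_lin_form.
have PA bK : (P (A bK) <= (4 / (tail_mass ^+ 2 * n%:R))%:E)%E.
  rewrite /A; case: ifPn => [_|g0].
    by rewrite measure0 lee_fin divr_ge0 // mulr_ge0 // sqr_ge0.
  have a0 := nzF _ g0.
  have qa : 0 < qf Sig (G bK.2 *m F) by rewrite FF sqn_gt0.
  by case: ifP => _; [exact: lin_right_count|exact: lin_left_count].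
have PBad3 : (P Bad3 <= (#|{: bool * {ffun 'I_d.+1 -> 'I_(N.*2.+1)}}|%:R *
    (4 / (tail_mass ^+ 2 * n%:R)))%:E)%E.
  by rewrite cardE; exact: probability_bigsetU_le.
have mBad1 : measurable Bad1.
  apply: measurable_ge_cst; under eq_fun => t do rewrite big_mkcond.
  apply: measurable_sum => i; case: (d < i)%N => //.
  exact: measurable_qf_sample_cov.
have mBad2 : measurable Bad2.
  by apply: measurable_ge_cst; apply: measurable_sum => i; exact: measurable_qf_sample_cov.
have mBad3 : measurable Bad3 by exact: bigsetU_measurable.
apply: (@le_trans _ _ (P (Bad1 `|` Bad2 `|` Bad3))); last first.
  rewrite !EFinD.
  apply: le_trans (measureU2 _ _ _) _ => //; first exact: measurableU.
  apply: leeD => //; apply: le_trans (measureU2 _ _ _) _ => //.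
  exact: leeD.
apply: le_measure; rewrite ?inE.
- apply: measurable_le_cst; apply: measurable_funM => //; exact: measurable_g_stat.
- by apply: measurableU => //; exact: measurableU.
(* Off the bad events the two eigenvalue bounds hold, and they contradict [g_stat k / n <= M]. *)
move=> t /= gM; apply: contrapT => nBad.
have nB1 : ~ Bad1 t by move=> h; apply: nBad; left; left.
have nB2 : ~ Bad2 t by move=> h; apply: nBad; left; right.
have nB3 bK : ~ A bK t.
  move=> h; apply: nBad; right; rewrite /Bad3 -bigcup_seq.
  by exists bK => //=; rewrite mem_enum.
have psd a : 0 <= qf (S t) a by exact: qf_sample_cov_ge0.
have hK K : G K != 0 -> tail_mass / 2 * sqn (G K) <= qf (S t) (G K *m F).
  move=> g0; pose a := G K *m F; pose c := lin_mean mu a; pose sd := Num.sqrt (qf Sig a).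
  have indE (Q : T -> bool) (w : T) : \1_[set t | Q t] w = (Q w)%:R :> R.
    by rewrite indicE; congr (_%:R); congr nat_of_bool; apply/idP/idP; rewrite inE.
  have w1 : (tail_mass * n%:R / 2 : R) <= \sum_(i < n) (c + sd <= lin_form X a i t)%R%:R.
    have := nB3 (true, K); rewrite /A /= (negbTE g0) /= => /negP; rewrite -ltNge => /ltW.
    by move=> h; apply: (le_trans h); apply: ler_sum => i _; rewrite indE.
  have w2 : (tail_mass * n%:R / 2 : R) <= \sum_(i < n) (lin_form X a i t <= c - sd)%R%:R.
    have := nB3 (false, K); rewrite /A /= (negbTE g0) /= => /negP; rewrite -ltNge => /ltW.
    by move=> h; apply: (le_trans h); apply: ler_sum => i _; rewrite indE.
  have := qf_sample_cov_ge (fun i j => X i j t) a c sd _ n1 (sqrtr_ge0 _) w1 w2.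
  have -> : sd ^+ 2 = sqn (G K) by rewrite /sd /a FF sqr_sqrtr ?sqn_ge0.
  apply: le_trans; rewrite mulrA.
  by rewrite ler_wpM2r ?sqn_ge0 // ler_pdivlMl ?subr_gt0 ?ltr1n //; lra.
have hF : \sum_(i < d.+1) qf (S t) (row i F) <= C.
  by rewrite ltW // ltNge; apply/negP.
have net := qf_net _ (S t) d.+1 N F (tail_mass / 2) C psd N0 (ltW (divr_gt0 q0 (ltr0Sn R 1))) hK hF.
(* The net bound with [c = tail_mass / 2] in dimension [d.+1] gives the first factor; undoing the
   whitening multiplies the squared norm by at least [lam d]. *)
pose L := tail_mass / (8 * d.+1%:R) * lam d.
have L0 : 0 < L by rewrite mulr_gt0 // divr_gt0 // mulr_gt0.
have hL : L <= (eigs (S t))`_d.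
  apply: (@eigs_nth_ge _ _ _ _ U) => //; first exact: sample_cov_sym.
  move=> b; have -> : b *m U = (b *m diag_mx e) *m F.
    by rewrite /F mulmxA -(mulmxA b) ee mulmx1.
  apply: le_trans (net _ _); last by apply: le_trans hN _; lra.
  have -> : tail_mass / 2 / (4 * d.+1%:R) = tail_mass / (8 * d.+1%:R) :> R.
    by move: (pnatr_eq0 R d.+1); move: (d.+1%:R : R) => D D0; field; rewrite D0.
  rewrite /L -mulrA ler_wpM2l ?divr_ge0 ?mulr_ge0 ?(ltW q0) //.
  rewrite /sqn mulr_sumr; apply: ler_sum => i _.
  rewrite mul_mx_diag !mxE exprMn sqr_sqrtr ?(ltW (lamk0 i)) // mulrC.
  by rewrite ler_wpM2l ?sqr_ge0 // lamd // -ltnS.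
have hB : \sum_(i < p | (d < i)%N) (eigs (S t))`_i <= C * p%:R.
  apply: le_trans (sum_eigs_le _ V d.+1 (sample_cov_sym _) VV _) _ => //.
  by rewrite ltW // ltNge; apply/negP.
have := g_stat_gt (fun i j => X i j t) k d L C M n1 _ L0 C0 M0 hL hB hn hp h1 h2.
by rewrite kd dp => /(_ isT); rewrite ltNge gM.
Qed.

End OneSample.

(** * Asymptotics *)

Lemma cvg0_near_le (R : realType) (u : nat -> R) (e : R) :
  u @ \oo --> 0 -> 0 < e -> \forall n \near \oo, u n <= e.
Proof.
move=> u0 e0; have /cvgrPdist_le/(_ e e0) := u0; apply: filterS => n /=.
by rewrite sub0r normrN => /(le_trans (ler_norm _)).
Qed.

Lemma cvg_ereal0_near_le (R : realType) (u : nat -> \bar R) :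
  (forall n, u n \is a fin_num) -> (forall n, 0 <= u n)%E ->
  (forall e : R, 0 < e -> \forall n \near \oo, (u n <= e%:E)%E) ->
  u @ \oo --> 0%E.
Proof.
move=> ufin u0 hu; apply/fine_cvgP; split; first by near=> n.
apply/cvgrPdist_le => e e0; near=> n.
rewrite sub0r normrN ger0_norm ?fine_ge0 //= -lee_fin fineK //.
by near: n; exact: hu.
Unshelve. all: by end_near.
Qed.

(** Both regimes yield [p / lam^2 -> 0] and [p^2 / (n lam^2) -> 0]. In the first, [p / n] converges.
    In the second, the latter quantity is the square of [p / (sqrt n lam)], and it dominates the
    former once [p / n >= 1]. *)
Lemma growth_conditions (R : realType) (p : nat -> nat) (lam : nat -> R) :
  (forall n, 0 < lam n) ->
  ((exists gamma : R, 0 <= gamma /\ gamma != 1 /\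
      ((fun n => (p n)%:R / n%:R) @ \oo --> gamma) /\
      ((fun n => (p n)%:R / (lam n) ^+ 2) @ \oo --> 0))
   \/
   (((fun n => (p n)%:R / n%:R : R) @ \oo --> +oo) /\
    ((fun n => (p n)%:R / (n%:R * Num.sqrt (lam n))) @ \oo --> 0) /\
    ((fun n => (p n)%:R / (Num.sqrt n%:R * lam n)) @ \oo --> 0))) ->
  forall e : R, 0 < e -> \forall n \near \oo,
    (p n)%:R / (lam n) ^+ 2 <= e /\ (p n)%:R / n%:R * ((p n)%:R / (lam n) ^+ 2) <= e.
Proof.
move=> lam0 [[gamma [_ [_ [hg h0]]]]|[hinf [_ h0]]] e e0.
  have h1 : (fun n => (p n)%:R / n%:R * ((p n)%:R / lam n ^+ 2)) @ \oo --> 0.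
    by rewrite -(mulr0 gamma); exact: cvgM.
  near=> n; split; near: n; exact: cvg0_near_le.
have h1 : (fun n => (p n)%:R / n%:R * ((p n)%:R / lam n ^+ 2)) @ \oo --> 0.
  have -> : (fun n => (p n)%:R / n%:R * ((p n)%:R / lam n ^+ 2)) =
     (fun n => (p n)%:R / (Num.sqrt n%:R * lam n) * ((p n)%:R / (Num.sqrt n%:R * lam n))).
    apply/funext => n; rewrite -[in LHS](sqr_sqrtr (ler0n R n)).
    by rewrite !expr2 !invfM; ring.
  by rewrite -(mulr0 0); exact: cvgM.
have hge : \forall n \near \oo, 1 <= (p n)%:R / n%:R :> R.
  by move/cvgryPge : hinf; exact.
near=> n.
have h2 : (p n)%:R / n%:R * ((p n)%:R / lam n ^+ 2) <= e.
  by near: n; exact: cvg0_near_le.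
split => //; apply: le_trans h2; rewrite -[leLHS]mul1r.
by apply: ler_wpM2r; [rewrite divr_ge0 // sqr_ge0|near: n].
Unshelve. all: by end_near.
Qed.

Theorem theorem2 (R : realType)
  (p : nat -> nat)
  (dsp : nat -> measure_display) (T : forall n, measurableType (dsp n))
  (P : forall n, probability (T n) R)
  (mu : forall n, 'cV[R]_(p n)) (Sig : forall n, 'M[R]_(p n))
  (X : forall n, 'I_n -> 'I_(p n) -> {RV (P n) >-> R})
  (d : nat) (sigma2 : R) (lam : nat -> nat -> R) :
  ((fun n => (p n)%:R : R) @ \oo --> +oo) ->
  (forall n, gaussian_sample (mu n) (Sig n) (X n)) ->
  (forall n, posdef (Sig n)) ->
  (1 <= d)%N -> 0 < sigma2 ->
  (* eigenvalues of Sig n : lam n 0 >= ... >= lam n (d-1) > sigma2 = ... = sigma2 *)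
  (forall n, (d <= p n)%N) ->
  (forall n, char_poly (Sig n) =
      (\prod_(k < d) ('X - (lam n k)%:P)) * ('X - sigma2%:P) ^+ (p n - d)) ->
  (forall n k, (k.+1 < d)%N -> lam n k.+1 <= lam n k) ->
  (forall n, sigma2 < lam n d.-1) ->
  (forall k, (k < d)%N -> (fun n => lam n k) @ \oo --> +oo) ->
  ((exists gamma : R, 0 <= gamma /\ gamma != 1 /\
      ((fun n => (p n)%:R / n%:R) @ \oo --> gamma) /\
      ((fun n => (p n)%:R / (lam n d.-1) ^+ 2) @ \oo --> 0))
   \/
   (((fun n => (p n)%:R / n%:R : R) @ \oo --> +oo) /\
    ((fun n => (p n)%:R / (n%:R * Num.sqrt (lam n d.-1))) @ \oo --> 0) /\
    ((fun n => (p n)%:R / (Num.sqrt n%:R * lam n d.-1)) @ \oo --> 0))) ->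
  forall k : nat, (k < d)%N -> forall M : R, 0 < M ->
    (fun n => P n [set t | g_stat k (fun i j => X n i j t) / n%:R <= M])
      @ \oo --> 0%E.
Proof.
(* From here on there are [d.+1] spikes, and the smallest is [lam n d]. *)
move=> hp HX HSig; case: d => // d _ s20 hd hch hlam hlams _ hgrow k kd M M0.
rewrite /= in hlams hgrow.
have lam0 n : 0 < lam n d by exact: lt_trans (hlams n).
have {}hgrow := growth_conditions _ p (fun n => lam n d) lam0 hgrow.
have lamd n i : (i <= d)%N -> lam n d <= lam n i.
  move=> id; have H m : (i + m <= d)%N -> lam n (i + m)%N <= lam n i.
    elim: m => [|m IH]; first by rewrite addn0.
    rewrite addnS => imd; apply: le_trans (IH (ltnW imd)).
    by apply: hlam; rewrite ltnS.
  by have := H (d - i)%N; rewrite subnKC // leqnn => /(_ isT).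
have q0 := @tail_mass_gt0 R; set q := @tail_mass R in q0.
have mset n : measurable [set t | g_stat k (fun i j => X n i j t) / n%:R <= M].
  apply: measurable_le_cst; apply: measurable_funM => //.
  exact: measurable_g_stat.
apply: cvg_ereal0_near_le => [n|n|e e0]; [exact: fin_num_measure|by []|].
have d0 : 0 < d.+1%:R :> R by [].
(* The two Markov terms then add up to exactly [e / 2]. The target [e] fixes [C], which fixes the
   mesh, and only then is [n] taken large. *)
pose C := 24 * (sigma2 + d.+1%:R) / e.
have C0 : 0 < C by rewrite divr_gt0 // mulr_gt0 // addr_gt0.
(* Fine enough that even [N], hence [N^2], exceeds the required ratio; the successor keeps it
   positive. *)
pose N := (Num.bound (2 ^+ d.+1 * C * 8 / q)).+1.
have hN : 2 ^+ d.+1 * C / N%:R ^+ 2 <= q / 8.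
  have N0 : 0 < N%:R :> R by [].
  have h : 2 ^+ d.+1 * C * 8 / q <= N%:R.
    have x0 : 0 <= 2 ^+ d.+1 * C * 8 / q.
      apply: divr_ge0; last exact: ltW.
      by apply: mulr_ge0 => //; apply: mulr_ge0; [exact: exprn_ge0|exact: ltW].
    by apply: le_trans (ltW (archi_boundP x0)) _; rewrite ler_nat.
  rewrite ler_pdivrMr ?exprn_gt0 // mulrAC ler_pdivlMr //.
  rewrite ler_pdivrMr // in h; apply: (le_trans h).
  rewrite mulrC ler_pM2l // -[leLHS]mulr1 expr2 ler_pM2l // ler1n //.
pose c1 := q / (8 * d.+1%:R).
have c10 : 0 < c1 by rewrite divr_gt0 // mulr_gt0.
pose card : R := #|{: bool * {ffun 'I_d.+1 -> 'I_(N.*2.+1)}}|%:R.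
(* With both growth quantities at most [eta], the left side of [h2] over [lam^2] is at most
   [(16 + 32) / 64 = 3 / 4] of [c1^2]. *)
pose eta := c1 ^+ 2 / (64 * C ^+ 2 * (1 + 2 * M)).
have M1 : 0 < 1 + 2 * M by rewrite addr_gt0 // mulr_gt0.
have eta0 : 0 < eta.
  apply: divr_gt0; first exact: exprn_gt0.
  by apply: mulr_gt0 => //; apply: mulr_gt0 => //; exact: exprn_gt0.
have pge (A : R) : \forall n \near \oo, A <= (p n)%:R.
  by move/cvgryPge : hp; exact.
near=> n.
have n1 : (1 < n)%N by near: n; exact: nbhs_infty_gt.
have n0 : 0 < n%:R :> R by rewrite ltr0n ltnW.
have hn : 2 * k.+1%:R <= n%:R :> R by near: n; exact: nbhs_infty_ger.
have hpk : 2 * k%:R <= (p n)%:R :> R by near: n; exact: pge.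
(* This bound and the next one make the left side of [h1] at most [p / 4 + p / 2]. *)
have hpM : 64 * d.+1%:R ^+ 2 * (1 + 2 * M) <= (p n)%:R :> R by near: n; exact: pge.
have hnd : 64 * d.+1%:R ^+ 2 <= n%:R :> R by near: n; exact: nbhs_infty_ger.
(* Brings the union bound over the grid below [e / 2]. *)
have hnc : 8 * card / (q ^+ 2 * e) <= n%:R by near: n; exact: nbhs_infty_ger.
have [g1 g2] : (p n)%:R / lam n d ^+ 2 <= eta /\
    (p n)%:R / n%:R * ((p n)%:R / lam n d ^+ 2) <= eta.
  by near: n; exact: hgrow.
have dp : (d < p n)%N := hd n.
have p0 : 0 < (p n)%:R :> R by rewrite ltr0n (leq_ltn_trans _ dp).
set pn : R := (p n)%:R in hpk hpM g1 g2 p0 *.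
have h1 : 16 * d.+1%:R ^+ 2 * (1 + 2 * M + 2 * (pn / n%:R)) < pn.
  have : 64 * d.+1%:R ^+ 2 * (pn / n%:R) <= pn.
    by rewrite mulrA ler_pdivrMr // mulrC ler_pM2l.
  move: hpM; set D := d.+1%:R ^+ 2; set Y := 1 + 2 * M; set Z := pn / _.
  rewrite -!(mulrA 64) => hY hZ.
  have -> : 16 * D * (Y + 2 * Z) = 16 * (D * Y) + 32 * (D * Z) by ring.
  by move: (D * Y) (D * Z) hY hZ => DY DZ hY hZ; lra.
have l20 : 0 < lam n d ^+ 2 by rewrite exprn_gt0.
have h2 : 16 * C ^+ 2 * pn * (1 + 2 * M + 2 * (pn / n%:R)) < (c1 * lam n d) ^+ 2.
  rewrite [ltRHS]exprMn -(ltr_pdivrMr _ _ l20).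
  have -> : 16 * C ^+ 2 * pn * (1 + 2 * M + 2 * (pn / n%:R)) / lam n d ^+ 2 =
     16 * C ^+ 2 * (1 + 2 * M) * (pn / lam n d ^+ 2) +
     32 * C ^+ 2 * (pn / n%:R * (pn / lam n d ^+ 2)).
    by field; rewrite !gt_eqF.
  have C20 : 0 < C ^+ 2 by rewrite exprn_gt0.
  have etaE : 64 * C ^+ 2 * (1 + 2 * M) * eta = c1 ^+ 2.
    by rewrite /eta; field; rewrite !gt_eqF.
  have c20 : 0 < c1 ^+ 2 by rewrite exprn_gt0.
  have e1 : C ^+ 2 * (1 + 2 * M) * (pn / lam n d ^+ 2) <= C ^+ 2 * (1 + 2 * M) * eta.
    by rewrite ler_pM2l // mulr_gt0.
  have e2 : C ^+ 2 * (pn / n%:R * (pn / lam n d ^+ 2)) <= C ^+ 2 * (1 + 2 * M) * eta.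
    rewrite -[leRHS]mulrA ler_pM2l //; apply: (le_trans g2).
    by rewrite -[leLHS]mul1r ler_pM2r //; lra.
  set E1 := C ^+ 2 * (1 + 2 * M) * (_ / _) in e1.
  set E2 := C ^+ 2 * (_ * _) in e2.
  set E3 := C ^+ 2 * (1 + 2 * M) * eta in e1 e2.
  have -> : 16 * C ^+ 2 * (1 + 2 * M) * (pn / lam n d ^+ 2) = 16 * E1 by rewrite /E1; ring.
  have -> : 32 * C ^+ 2 * (pn / n%:R * (pn / lam n d ^+ 2)) = 32 * E2 by rewrite /E2; ring.
  have E3E : 64 * E3 = c1 ^+ 2 by rewrite -etaE /E3; ring.
  lra.
have symS : (Sig n)^T = Sig n by have [] := HSig n.
have kdp : (k <= d < p n)%N by rewrite -ltnS kd dp.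
have := g_stat_prob_le (mu n) (Sig n) (X n) (HX n) n1 k d N sigma2 C M (lam n)
  symS kdp s20 (hch n) (lamd n) (hlams n) C0 M0 (ltn0Sn _) hN hn hpk h1 h2.
move=> /le_trans; apply; rewrite lee_fin -/card -/q.
have -> : 12 * sigma2 / C + 12 * d.+1%:R / C = e / 2.
  by rewrite /C; field; rewrite !gt_eqF // addr_gt0.
have : card * (4 / (q ^+ 2 * n%:R)) <= e / 2.
  have q20 : 0 < q ^+ 2 by rewrite exprn_gt0.
  rewrite ler_pdivrMr in hnc; last by rewrite mulr_gt0.
  rewrite mulrA ler_pdivrMr; last by rewrite mulr_gt0.
  have -> : e / 2 * (q ^+ 2 * n%:R) = n%:R * (q ^+ 2 * e) / 2 by ring.
  lra.
lra.
Unshelve. all: by end_near.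
Qed.
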